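(* Let $\mathcal{M}$ be a smooth 4-dimensional manifold, and let $g_{ab}$ and $\tilde g_{ab}$ be smooth pseudo-Riemannian metrics on $\mathcal{M}$ with $g_{ab}=\Theta^2\tilde g_{ab}$ for a smooth positive function $\Theta$. Assume that $C_{abcd}C^{abcd}\neq0$ at every point, where $C_{abcd}$ is the Weyl tensor of $g_{ab}$. Let $\mathcal{C}$ and $\tilde{\mathcal{C}}$ be the $\mathcal{C}$-connections of $g_{ab}$ and of $\tilde g_{ab}$ respectively. Then the $\mathcal{C}$-connection is conformally invariant: $$\tilde{\mathcal{C}}_a=\mathcal{C}_a .$$
   Context: Abstract index notation is used; square brackets denote antisymmetrization with weight one. For a pseudo-Riemannian metric $g_{ab}$ with Levi-Civita connection $\nabla$, indices being raised and lowered with $g_{ab}$, the curvature conventions are: $\nabla_a\nabla_b\omega_c-\nabla_b\nabla_a\omega_c=R_{abc}{}^d\omega_d$; $R_{ac}=R_{abc}{}^b$; $R=g^{ab}R_{ab}$; Schouten tensor $L_{ab}=\frac12(R_{ab}-\frac16Rg_{ab})$; Weyl tensor $C_{abc}{}^d=R_{abc}{}^d-2L^d{}_{[b}g_{a]c}-2\delta^d{}_{[b}L_{a]c}$. Where $C\cdot C=C_{abcd}C^{abcd}$ is nowhere zero, define the covector field $$\Lambda_d=\frac{8\,C_d{}^{amp}\nabla_{[m}L_{p]a}}{C\cdot C}.$$ The $\mathcal{C}$-connection of $g_{ab}$ is the torsion-free affine connection $\mathcal{C}$ whose action on covector fields is $$\mathcal{C}_a\omega_b=\nabla_a\omega_b+\Lambda_a\omega_b+\Lambda_b\omega_a-g_{ab}g^{cd}\Lambda_d\,\omega_c$$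 (extended to all tensor fields as a covariant derivative). The connection $\tilde{\mathcal{C}}$ is defined by the same formulas with every object (Levi-Civita connection, curvature tensors, index raising, $\Lambda$) constructed from $\tilde g_{ab}$ instead of $g_{ab}$. *)

(* Defs.v *)
From HB Require Import structures.
From mathcomp Require Import all_boot all_order all_algebra.
From mathcomp Require Import all_classical all_reals all_analysis.

Set Implicit Arguments.
Unset Strict Implicit.
Unset Printing Implicit Defensive.

Import Order.TTheory GRing.Theory Num.Theory.
Import numFieldNormedType.Exports.

Local Open Scope classical_set_scope.
Local Open Scope ring_scope.

Definition partial (R : realType) (n : nat) (a : 'I_n) (f : 'rV[R]_n -> R) :
  'rV[R]_n -> R := fun x => 'D_(delta_mx 0 a) f x.

(* C^oo on the open set V: f and all its iterated partial derivatives are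
   (Frechet) differentiable at every point of V. *)
Definition smooth_on (R : realType) (n : nat) (V : set 'rV[R]_n)
    (f : 'rV[R]_n -> R) : Prop :=
  forall (s : seq 'I_n) (x : 'rV[R]_n), V x ->
    differentiable (foldr (@partial R n) f s) x.

(* The chart [i] is the homeomorphism [phi i] from the open set [dom i] onto
   the open set [cod i] of R^n, with inverse [psi i]; the values of [phi i] and
   [psi i] outside [dom i] and [cod i] are irrelevant. *)
Record manifold (R : realType) (n : nat) := Manifold {
  carrier :> topologicalType;
  carrier_hausdorff : hausdorff_space carrier;
  carrier_second_countable : @second_countable carrier;
  chart : Type;
  dom : chart -> set carrier;
  cod : chart -> set 'rV[R]_n;
  phi : chart -> carrier -> 'rV[R]_n;
  psi : chart -> 'rV[R]_n -> carrier;
  dom_open : forall i, open (dom i);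
  cod_open : forall i, open (cod i);
  phi_cod : forall i p, dom i p -> cod i (phi i p);
  psi_dom : forall i x, cod i x -> dom i (psi i x);
  phiK : forall i p, dom i p -> psi i (phi i p) = p;
  psiK : forall i x, cod i x -> phi i (psi i x) = x;
  phi_continuous : forall i, {within dom i, continuous (phi i)};
  psi_continuous : forall i, {within cod i, continuous (psi i)};
  chart_cover : forall p, exists i, dom i p;
  transition_smooth : forall (i j : chart) (c : 'I_n),
    smooth_on [set x | cod i x /\ dom j (psi i x)]
              (fun x => phi j (psi i x) 0 c)
}.

Arguments dom {R n M} i _ : rename.
Arguments cod {R n M} i _ : rename.
Arguments phi {R n M} i _ : rename.
Arguments psi {R n M} i _ : rename.

Definition transition (R : realType) (n : nat) (M : manifold R n)
    (i j : chart M) (x : 'rV[R]_n) : 'rV[R]_n := phi j (psi i x).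

(* d y^c / d x^a, for x and y the coordinates of the charts i and j. *)
Definition jac (R : realType) (n : nat) (M : manifold R n) (i j : chart M)
    (x : 'rV[R]_n) (c a : 'I_n) : R :=
  partial a (fun z => transition i j z 0 c) x.

Definition smooth_function (R : realType) (n : nat) (M : manifold R n)
    (f : M -> R) : Prop :=
  forall i : chart M, smooth_on (cod i) (fun x => f (psi i x)).

(* Components, in one chart, of a field of tensors with r upper and s lower
   indices: [T x U L] is T^U_L at the point of coordinates x. *)
Definition components (R : realType) (n r s : nat) : Type :=
  'rV[R]_n -> r.-tuple 'I_n -> s.-tuple 'I_n -> R.

(* Smooth tensor fields of type (r, s) on the open subset W of M.  The
   transformation law is the usual one, multiplied by Jacobians so that the
   inverse Jacobian does not occur. *)
Record tensor_field (R : realType) (n : nat) (M : manifold R n) (W : set M)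
    (r s : nat) := TensorField {
  tensor_comp :> chart M -> components R n r s;
  tensor_smooth : forall i U L,
    smooth_on [set x | cod i x /\ W (psi i x)] (fun x => tensor_comp i x U L);
  tensor_law : forall (i j : chart M) (x : 'rV[R]_n) U L,
    cod i x -> dom j (psi i x) -> W (psi i x) ->
    \sum_(A : r.-tuple 'I_n)
       (\prod_(k < r) jac i j x (tnth U k) (tnth A k)) * tensor_comp i x A L =
    \sum_(B : s.-tuple 'I_n)
       tensor_comp j (transition i j x) U B *
       \prod_(k < s) jac i j x (tnth B k) (tnth L k)
}.

Record metric (R : realType) (n : nat) (M : manifold R n) := Metric {
  metric_tensor :> tensor_field (M := M) setT 0 2;
  metric_sym : forall i x (a b : 'I_n), cod i x ->
    metric_tensor i x [tuple] [tuple a; b] =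
    metric_tensor i x [tuple] [tuple b; a];
  metric_nondegenerate : forall i x, cod i x ->
    \matrix_(a, b) metric_tensor i x [tuple] [tuple a; b] \in unitmx
}.

(* Affine connections, through their coefficients: [G i x c a b] is
   Gamma^c_{ab} in the chart i, where
   nabla_a w_b = d_a w_b - Gamma^c_{ab} w_c. *)
Definition coefficients (R : realType) (n : nat) : Type :=
  'rV[R]_n -> 'I_n -> 'I_n -> 'I_n -> R.

Record connection (R : realType) (n : nat) (M : manifold R n) := Connection {
  connection_coef :> chart M -> coefficients R n;
  connection_smooth : forall i c a b,
    smooth_on (cod i) (fun x => connection_coef i x c a b);
  connection_law : forall (i j : chart M) (x : 'rV[R]_n) (e a b : 'I_n),
    cod i x -> dom j (psi i x) ->
    \sum_(c < n) jac i j x e c * connection_coef i x c a b =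
    partial a (partial b (fun z => transition i j z 0 e)) x +
    \sum_(f < n) \sum_(h < n)
       connection_coef j (transition i j x) e f h *
       jac i j x f a * jac i j x h b
}.

Definition subst_index (n s : nat) (L : s.-tuple 'I_n) (k : 'I_s) (e : 'I_n) :
  s.-tuple 'I_n := [tuple if j == k then e else tnth L j | j < s].

(* Covariant derivative of a field of tensors; the differentiation index is
   the first lower index of the result:
   [cov G T x U [tuple of a :: L]] is nabla_a T^U_L. *)
Definition cov (R : realType) (n r s : nat) (G : coefficients R n)
    (T : components R n r s) : components R n r s.+1 :=
  fun x U aL =>
    let a := thead aL in
    let L := [tuple of behead aL] in
    partial a (fun y => T y U L) x
    + \sum_(k < r) \sum_(e < n) G x (tnth U k) a e * T x (subst_index U k e) L
    - \sum_(k < s) \sum_(e < n) G x e a (tnth L k) * T x U (subst_index L k e).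

Definition torsion_free (R : realType) (n : nat) (M : manifold R n)
    (D : connection M) : Prop :=
  forall i x (c a b : 'I_n), cod i x -> D i x c a b = D i x c b a.

Definition levi_civita (R : realType) (n : nat) (M : manifold R n)
    (g : metric M) (D : connection M) : Prop :=
  torsion_free D /\
  forall i x U L, cod i x -> cov (D i) (g i) x U L = 0.

Definition asym (R : realType) (n : nat) (X : 'I_n -> 'I_n -> R) (a b : 'I_n) :
  R := 2^-1 * (X a b - X b a).

Definition coordinate_covector (R : realType) (n : nat) (d : 'I_n) :
  components R n 0 1 := fun _ _ L => (thead L == d)%:R.

(* R_{abc}^d, determined by
   nabla_a nabla_b w_c - nabla_b nabla_a w_c = R_{abc}^d w_d
   (G without torsion), read off at w = dx^d. *)
Definition riemann (R : realType) (n : nat) (G : coefficients R n)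
    (x : 'rV[R]_n) (a b c d : 'I_n) : R :=
  cov G (cov G (@coordinate_covector R n d)) x [tuple] [tuple a; b; c] -
  cov G (cov G (@coordinate_covector R n d)) x [tuple] [tuple b; a; c].

Definition ricci (R : realType) (n : nat) (G : coefficients R n)
    (x : 'rV[R]_n) (a c : 'I_n) : R :=
  \sum_(b < n) riemann G x a b c b.

Definition lo (R : realType) (n : nat) (g : components R n 0 2)
    (x : 'rV[R]_n) (a b : 'I_n) : R := g x [tuple] [tuple a; b].

Definition up (R : realType) (n : nat) (g : components R n 0 2)
    (x : 'rV[R]_n) (a b : 'I_n) : R :=
  invmx (\matrix_(c, d) lo g x c d) a b.

Definition scalar_curvature (R : realType) (n : nat) (g : components R n 0 2)
    (G : coefficients R n) (x : 'rV[R]_n) : R :=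
  \sum_(a < n) \sum_(b < n) up g x a b * ricci G x a b.

Definition schouten (R : realType) (g : components R 4 0 2)
    (G : coefficients R 4) : components R 4 0 2 :=
  fun x _ ab =>
    let a := tnth ab 0 in
    let b := tnth ab 1 in
    2^-1 * (ricci G x a b - 6^-1 * scalar_curvature g G x * lo g x a b).

(* L^a_b *)
Definition schouten_mixed (R : realType) (g : components R 4 0 2)
    (G : coefficients R 4) (x : 'rV[R]_4) (a b : 'I_4) : R :=
  \sum_(e < 4) up g x a e * lo (schouten g G) x e b.

(* C_{abc}^d *)
Definition weyl (R : realType) (g : components R 4 0 2)
    (G : coefficients R 4) (x : 'rV[R]_4) (a b c d : 'I_4) : R :=
  riemann G x a b c d
  - 2 * asym (fun b' a' => schouten_mixed g G x d b' * lo g x a' c) b a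
  - 2 * asym (fun b' a' => (d == b')%:R * lo (schouten g G) x a' c) b a.

(* C_{abcd} *)
Definition weyl_lo (R : realType) (g : components R 4 0 2)
    (G : coefficients R 4) (x : 'rV[R]_4) (a b c d : 'I_4) : R :=
  \sum_(e < 4) weyl g G x a b c e * lo g x e d.

(* C_d^{amp} *)
Definition weyl_up3 (R : realType) (g : components R 4 0 2)
    (G : coefficients R 4) (x : 'rV[R]_4) (d a m p : 'I_4) : R :=
  \sum_(a' < 4) \sum_(m' < 4) \sum_(p' < 4)
    up g x a a' * up g x m m' * up g x p p' * weyl_lo g G x d a' m' p'.

(* C_{abcd} C^{abcd} *)
Definition weyl_sq (R : realType) (g : components R 4 0 2)
    (G : coefficients R 4) (x : 'rV[R]_4) : R :=
  \sum_(a < 4) \sum_(b < 4) \sum_(c < 4) \sum_(d < 4)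
    weyl_lo g G x a b c d *
    \sum_(a' < 4) up g x a a' * weyl_up3 g G x a' b c d.

Definition Lambda (R : realType) (g : components R 4 0 2)
    (G : coefficients R 4) (x : 'rV[R]_4) (d : 'I_4) : R :=
  (8 * \sum_(a < 4) \sum_(m < 4) \sum_(p < 4)
         weyl_up3 g G x d a m p *
         asym (fun m' p' =>
                 cov G (schouten g G) x [tuple] [tuple m'; p'; a]) m p)
  / weyl_sq g G x.

(* [C] is the C-connection of g, whose Levi-Civita connection is [D]; covector
   fields [w] on arbitrary open subsets of M are considered. *)
Definition C_connection (R : realType) (M : manifold R 4) (g : metric M)
    (D C : connection M) : Prop :=
  torsion_free C /\
  forall (W : set M) (w : tensor_field W 0 1), open W ->
  forall (i : chart M) (x : 'rV[R]_4) (a b : 'I_4), cod i x -> W (psi i x) ->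
    let w_ c := w i x [tuple] [tuple c] in
    cov (C i) (w i) x [tuple] [tuple a; b] =
    cov (D i) (w i) x [tuple] [tuple a; b]
    + Lambda (g i) (D i) x a * w_ b + Lambda (g i) (D i) x b * w_ a
    - lo (g i) x a b *
      \sum_(c < 4) \sum_(d < 4) up (g i) x c d * Lambda (g i) (D i) x d * w_ c.

(* Main.v *)
Require Import Defs.
From HB Require Import structures.
From mathcomp Require Import all_boot all_order all_algebra.
From mathcomp Require Import all_classical all_reals all_analysis.
From mathcomp Require Import perm ring lra.

(** Write Y for the gradient of the logarithm of [Theta], which in a chart is
    [dlog].  Evaluating a C-connection on the coordinate forms determines its
    coefficients ([C_connection_coef]): they are
      Gamma^d_{ab} - l_a delta^d_b - l_b delta^d_a + g_{ab} g^{de} l_e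
    with l the covector [Lambda] of the metric.  Koszul's formula shows that
    the passage from [gt] to [g] adds
      Y_a delta^d_b + Y_b delta^d_a - g_{ab} g^{de} Y_e
    to the Levi-Civita coefficients ([christoffel_conformal]), and the tensor
    g_{ab} g^{de} is the same for both metrics.  Hence the theorem says that l
    transforms by adding Y ([Lambda_conformal]).

    The change of the connection modifies the curvature by terms built from one
    symmetric tensor P, [schouten_shift].  These terms have the shape of
    the Schouten terms in the definition of the Weyl tensor, so the Schouten
    tensor changes by -P ([schouten_conformal]) and the Weyl tensor
    C_{abc}^d is unchanged ([weyl_conformal]).  In the curl of the Schouten
    tensor, the derivatives of P produce the curvature contracted with Y through
    the Ricci identity; its Schouten part cancels against the change of the
    connection, and 2 nabla_{[m} L_{p]a} changes by exactly -C_{mpa}^e Y_e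
    ([cov_curl_schouten_conformal]).  The powers of [Theta] cancel in the
    quotient defining [Lambda], whose numerator therefore changes, up to these
    powers, by -4 C_d^{amp} C_{mpa}^e Y_e.

    What makes this equal to (C.C) Y_d is that C_{dabc} C^{eabc} is a quarter
    of C.C times the identity ([weyl_up3_weyl]).  The reason is
    algebraic: in four dimensions a tensor M_{ab}^{cd} that is antisymmetric in
    both pairs and trace-free is compatible with the exchange of complementary
    index pairs ([weyl_quadratic]).

    The calculus behind these computations consists of the closure of
    [smooth_on] under the rational operations and the symmetry of second
    derivatives ([partial_comm]). *)

Set Implicit Arguments.
Unset Strict Implicit.
Unset Printing Implicit Defensive.

Import Order.TTheory GRing.Theory Num.Theory.
Import numFieldNormedType.Exports.

Local Open Scope classical_set_scope.
Local Open Scope ring_scope.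

(** * Smooth functions of several variables *)

Lemma near_eq_differentiable (K : numFieldType) (V W : normedModType K)
    (f g : V -> W) (x : V) :
  (\forall y \near x, f y = g y) -> differentiable f x -> differentiable g x.
Proof.
move=> fg df; have [cdf dfE] := (diff_locallyP _ _).1 df.
have gx : g x = f x by rewrite (nbhs_singleton fg).
have dgE : g \o shift x = cst (g x) + 'd f x +o_ 0 id.
  apply/eqaddoP => e e0; have /eqaddoP/(_ e e0) := dfE.
  have fg0 : \forall y \near (0 : V), f (y + x) = g (y + x).
    by move: fg; rewrite (near_shift 0); apply: filterS => y /=; rewrite subr0.
  by apply: filterS2 fg0 => y /= fgy; rewrite !fctE /= -fgy gx.
have dg := diff_unique cdf dgE.
by apply/diff_locallyP; rewrite dg.
Qed.

Section Calculus.
Context {R : realType} {n : nat}.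
Implicit Types (V : set 'rV[R]_n) (f g : 'rV[R]_n -> R) (x : 'rV[R]_n).
Implicit Types (a b : 'I_n).

Lemma smooth_on_differentiable V f x :
  smooth_on V f -> V x -> differentiable f x.
Proof. by move=> /(_ [::] x) /= sf Vx; exact: sf. Qed.

Lemma smooth_on_derivable V f x v : smooth_on V f -> V x -> derivable f x v.
Proof.
move=> sf Vx; apply: diff_derivable.
exact: smooth_on_differentiable sf Vx.
Qed.

Lemma smooth_on_partial V f a : smooth_on V f -> smooth_on V (partial a f).
Proof. by move=> sf s x Vx; have := sf (rcons s a) x Vx; rewrite foldr_rcons. Qed.

Lemma near_open V x (P : 'rV[R]_n -> Prop) :
  open V -> V x -> (forall y, V y -> P y) -> \forall y \near x, P y.
Proof.
move=> oV Vx VP; apply: (@filterS _ _ _ V) => //; exact: open_nbhs_nbhs.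
Qed.

Lemma eq_partial V f g a x : open V -> (forall y, V y -> f y = g y) ->
  V x -> partial a f x = partial a g x.
Proof. by move=> oV fg Vx; apply: near_eq_derive; exact: near_open fg. Qed.


Lemma smooth_on_ext V f g : open V -> (forall y, V y -> f y = g y) ->
  smooth_on V f -> smooth_on V g.
Proof.
move=> oV fg sf s x Vx.
have E : forall s y, V y ->
    foldr (@partial R n) f s y = foldr (@partial R n) g s y.
  elim=> [|a t IH] y Vy /=; first exact: fg.
  exact: eq_partial oV IH Vy.
by apply: near_eq_differentiable (sf s x Vx); apply: near_open (E s).
Qed.

(** In [smooth_on] the last entry of the list differentiates first.  Here that
    entry is taken off, so that an induction on the order replaces a function by
    its first derivatives. *)
Fixpoint smooth_upto (k : nat) V f : Prop :=
  (forall x, V x -> differentiable f x) /\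
  (if k is k'.+1 then forall a, smooth_upto k' V (partial a f) else True).

Lemma smooth_uptoP V f : smooth_on V f <-> forall k, smooth_upto k V f.
Proof.
split=> [sf k|sf s].
  elim: k f sf => [|k IH] f sf; split=> //;
    try by move=> x; exact: smooth_on_differentiable.
  by move=> a; apply: IH; exact: smooth_on_partial.
move: (sf (size s)); elim/last_ind: s f {sf} => [|s a IH] f; first by case.
by rewrite size_rcons foldr_rcons => -[_ /(_ a)]; exact: IH.
Qed.

Lemma smooth_uptoS k V f : smooth_upto k.+1 V f -> smooth_upto k V f.
Proof.
elim: k f => [|k IH] f [df sf]; split=> // a.
by apply: IH; exact: sf.
Qed.

Lemma smooth_upto_ext k V f g : open V -> (forall y, V y -> f y = g y) ->
  smooth_upto k V f -> smooth_upto k V g.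
Proof.
move=> oV; elim: k f g => [|k IH] f g fg [df sf]; split=> //.
- by move=> x Vx; apply: near_eq_differentiable (df x Vx); exact: near_open fg.
- by move=> x Vx; apply: near_eq_differentiable (df x Vx); exact: near_open fg.
- by move=> a; apply: IH (sf a) => y; exact: eq_partial.
Qed.

(** By induction on the order: the first derivatives of sums, products and
    inverses are polynomials in functions of the same kind and of lower order. *)
Lemma smooth_uptoD k V f g : open V ->
  smooth_upto k V f -> smooth_upto k V g -> smooth_upto k V (fun x => f x + g x).
Proof.
move=> oV; elim: k f g => [|k IH] f g [df sf] [dg sg]; split=> //;
  try by move=> x Vx; apply: differentiableD; [exact: df | exact: dg].
move=> a; apply: smooth_upto_ext (IH _ _ (sf a) (sg a)) => // y Vy.
by rewrite /partial deriveD//; apply: diff_derivable; [exact: df | exact: dg].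
Qed.

Lemma smooth_uptoM k V f g : open V ->
  smooth_upto k V f -> smooth_upto k V g -> smooth_upto k V (fun x => f x * g x).
Proof.
move=> oV; elim: k f g => [|k IH] f g.
  move=> [df _] [dg _]; split=> // x Vx.
  by apply: differentiableM; [exact: df | exact: dg].
move=> sf sg; have [df sf1] := sf; have [dg sg1] := sg; split.
  by move=> x Vx; apply: differentiableM; [exact: df | exact: dg].
move=> a; apply: smooth_upto_ext (smooth_uptoD oV
  (IH _ _ (smooth_uptoS sf) (sg1 a)) (IH _ _ (sf1 a) (smooth_uptoS sg))) => // y Vy.
rewrite /partial deriveM; first by rewrite /GRing.scale/= [g y * _]mulrC.
- by apply: diff_derivable; exact: df.
- by apply: diff_derivable; exact: dg.
Qed.

Lemma smooth_upto_cst k V (c : R) : smooth_upto k V (fun=> c).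
Proof.
elim: k c => [|k IH] c; split=> //; try by move=> x _; exact: differentiable_cst.
by move=> a; rewrite (_ : partial _ _ = fun=> 0)//; apply/funext => y; exact: derive_cst.
Qed.

Lemma smooth_uptoV k V f : open V -> (forall x, V x -> f x != 0) ->
  smooth_upto k V f -> smooth_upto k V (fun x => (f x)^-1).
Proof.
move=> oV f0; elim: k => [|k IH].
  by move=> [df _]; split=> // x Vx; apply: differentiableV; [exact: df | exact: f0].
move=> sf; have [df sf1] := sf; split.
  by move=> x Vx; apply: differentiableV; [exact: df | exact: f0].
have sV := IH (smooth_uptoS sf).
move=> a; apply: smooth_upto_ext (smooth_uptoM oV (smooth_uptoM oV
  (smooth_upto_cst _ _ (-1)) (smooth_uptoM oV sV sV)) (sf1 a)) => // y Vy.
rewrite /partial deriveV ?f0//; last by apply: diff_derivable; exact: df.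
by rewrite /GRing.scale/= expr2 invfM mulN1r.
Qed.

Lemma smooth_onD V f g : open V ->
  smooth_on V f -> smooth_on V g -> smooth_on V (fun x => f x + g x).
Proof.
move=> oV /smooth_uptoP sf /smooth_uptoP sg; apply/smooth_uptoP => k.
exact: smooth_uptoD.
Qed.

Lemma smooth_onM V f g : open V ->
  smooth_on V f -> smooth_on V g -> smooth_on V (fun x => f x * g x).
Proof.
move=> oV /smooth_uptoP sf /smooth_uptoP sg; apply/smooth_uptoP => k.
exact: smooth_uptoM.
Qed.

Lemma smooth_on_cst V (c : R) : smooth_on V (fun=> c).
Proof. by apply/smooth_uptoP => k; exact: smooth_upto_cst. Qed.

Lemma smooth_onV V f : open V -> (forall x, V x -> f x != 0) ->
  smooth_on V f -> smooth_on V (fun x => (f x)^-1).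
Proof. by move=> oV f0 /smooth_uptoP sf; apply/smooth_uptoP => k; exact: smooth_uptoV. Qed.

Lemma smooth_onN V f : open V -> smooth_on V f -> smooth_on V (fun x => - f x).
Proof.
move=> oV sf; apply: (smooth_on_ext oV _ (smooth_onM oV (@smooth_on_cst V (-1)) sf)) => //.
by move=> y _; rewrite mulN1r.
Qed.

Lemma smooth_onB V f g : open V ->
  smooth_on V f -> smooth_on V g -> smooth_on V (fun x => f x - g x).
Proof. by move=> oV sf sg; apply: smooth_onD => //; exact: smooth_onN. Qed.

Lemma smooth_on_sum V (I : Type) (r : seq I) (P : pred I)
    (F : I -> 'rV[R]_n -> R) : open V ->
  (forall i, smooth_on V (F i)) -> smooth_on V (fun x => \sum_(i <- r | P i) F i x).
Proof.
move=> oV sF; elim: r => [|i r IH].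
  by apply: (smooth_on_ext oV _ (@smooth_on_cst V 0)) => // y _; rewrite big_nil.
apply: (@smooth_on_ext _ (fun x =>
  (if P i then F i x else 0) + \sum_(i <- r | P i) F i x)) => //.
  by move=> y _; rewrite big_cons; case: ifP; rewrite ?add0r.
by apply: smooth_onD => //; case: (P i) => //; exact: smooth_on_cst.
Qed.

Lemma smooth_on_prod V (I : Type) (r : seq I) (F : I -> 'rV[R]_n -> R) :
  open V -> (forall i, smooth_on V (F i)) ->
  smooth_on V (fun x => \prod_(i <- r) F i x).
Proof.
move=> oV sF; elim: r => [|i r IH].
  by apply: (smooth_on_ext oV _ (@smooth_on_cst V 1)) => // y _; rewrite big_nil.
apply: (smooth_on_ext oV _ (smooth_onM oV (sF i) IH)) => //.
by move=> y _; rewrite big_cons.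
Qed.

Lemma smooth_on_det V m (F : 'I_m -> 'I_m -> 'rV[R]_n -> R) : open V ->
  (forall i j, smooth_on V (F i j)) ->
  smooth_on V (fun x => \det (\matrix_(i, j) F i j x)).
Proof.
move=> oV sF; apply: (@smooth_on_ext _ (fun x =>
  \sum_(s : 'S_m) (-1) ^+ s * \prod_i F i (s i) x)) => //.
  by move=> y _; apply: eq_bigr => s _; congr (_ * _); apply: eq_bigr => i _; rewrite mxE.
apply: smooth_on_sum => // s; apply: smooth_onM => //; first exact: smooth_on_cst.
exact: smooth_on_prod.
Qed.

(** Cramer's rule writes the entries of the inverse as rational functions. *)
Lemma smooth_on_invmx V m (F : 'I_m -> 'I_m -> 'rV[R]_n -> R) i j : open V ->
  (forall x, V x -> \matrix_(i, j) F i j x \in unitmx) ->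
  (forall i j, smooth_on V (F i j)) ->
  smooth_on V (fun x => invmx (\matrix_(i, j) F i j x) i j).
Proof.
move=> oV uF sF; apply: (@smooth_on_ext _ (fun x =>
   (\det (\matrix_(i, j) F i j x))^-1 * ((-1) ^+ (j + i) *
     \det (\matrix_(k, l) F (lift j k) (lift i l) x)))) => //.
  move=> y Vy; rewrite /invmx uF// !mxE /cofactor; congr (_ * (_ * \det _)).
  by apply/matrixP => k l; rewrite !mxE.
apply: smooth_onM => //.
  apply: smooth_onV => //; last exact: smooth_on_det.
  by move=> x Vx; have := uF x Vx; rewrite unitmxE unitfE.
by apply: smooth_onM => //; [exact: smooth_on_cst | exact: smooth_on_det].
Qed.

Lemma partialD V f g a x : smooth_on V f -> smooth_on V g -> V x ->
  partial a (fun y => f y + g y) x = partial a f x + partial a g x.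
Proof.
move=> sf sg Vx; apply: deriveD; first exact: smooth_on_derivable sf Vx.
exact: smooth_on_derivable sg Vx.
Qed.

Lemma partialN V f a x : smooth_on V f -> V x ->
  partial a (fun y => - f y) x = - partial a f x.
Proof. by move=> sf Vx; apply: deriveN; exact: smooth_on_derivable sf Vx. Qed.

Lemma partialB V f g a x : smooth_on V f -> smooth_on V g -> V x ->
  partial a (fun y => f y - g y) x = partial a f x - partial a g x.
Proof.
move=> sf sg Vx; apply: deriveB; first exact: smooth_on_derivable sf Vx.
exact: smooth_on_derivable sg Vx.
Qed.

Lemma partialM V f g a x : smooth_on V f -> smooth_on V g -> V x ->
  partial a (fun y => f y * g y) x = partial a f x * g x + f x * partial a g x.
Proof.
move=> sf sg Vx; rewrite /partial deriveM.
- by rewrite addrC /GRing.scale/= [g x * _]mulrC.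
- exact: smooth_on_derivable sf Vx.
- exact: smooth_on_derivable sg Vx.
Qed.

Lemma partial_cst a (c : R) x : partial a (fun=> c) x = 0.
Proof. exact: derive_cst. Qed.

Lemma partial_sum V m (F : 'I_m -> 'rV[R]_n -> R) a x :
  (forall i, smooth_on V (F i)) -> V x ->
  partial a (fun y => \sum_(i < m) F i y) x = \sum_(i < m) partial a (F i) x.
Proof.
move=> sF Vx; rewrite /partial -derive_sum; last first.
  by move=> i; exact: smooth_on_derivable (sF i) Vx.
by congr ('D_ _ _ x); apply/funext => y; rewrite fct_sumE.
Qed.

Lemma partial_coord (c a : 'I_n) x :
  partial a (fun z : 'rV[R]_n => z 0 c) x = (c == a)%:R.
Proof.
rewrite /partial.
have := derive_mx (@derivable_id R _ x (delta_mx 0 a)).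
rewrite derive_id => /matrixP/(_ 0 c); rewrite !mxE eqxx/= => ->.
by [].
Qed.

Lemma partial_comp (F f : 'rV[R]_n -> 'rV[R]_n) (h : 'rV[R]_n -> R) a x :
  (forall b, differentiable (fun z => F z 0 b) x) -> differentiable h (F x) ->
  partial a (h \o F) x =
  \sum_(b < n) partial b h (F x) * partial a (fun z => F z 0 b) x.
Proof.
move=> dF dh.
have FE : F = \sum_(b < n) (fun z => F z 0 b *: (delta_mx 0 b : 'rV[R]_n)).
  by apply/funext => z; rewrite fct_sumE [LHS]row_sum_delta.
have dFx : differentiable F x.
  by rewrite FE; apply: differentiable_sum => b; apply: differentiableZl.
rewrite /partial deriveE; last exact: differentiable_comp.
rewrite diff_comp//= -(deriveE _ dFx) derive_mx; last exact: diff_derivable.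
rewrite [X in 'd h _ X]row_sum_delta linear_sum; apply: eq_bigr => b _.
by rewrite linearZ/= mxE -deriveE// mulrC.
Qed.

Local Notation e_ a := (delta_mx 0 a : 'rV[R]_n).

Lemma partial_MVT f a x (t : R) : 0 < t ->
  (forall s, 0 <= s <= t -> differentiable f (x + s *: e_ a)) ->
  exists2 s, 0 <= s <= t &
    f (x + t *: e_ a) - f x = t * partial a f (x + s *: e_ a).
Proof.
move=> t0 df.
have D s : 0 <= s <= t ->
    is_derive s 1 (fun s => f (x + s *: e_ a)) (partial a f (x + s *: e_ a)).
  move=> /df dfs.
  have E : (fun s : R => x + s *: e_ a) = (fun s : R => s *: e_ a) + cst x.
    by apply/funext => r; rewrite [LHS]addrC.
  have dl : is_diff s (fun s : R => x + s *: e_ a) (fun s : R => s *: e_ a).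
    by rewrite E; apply: is_diff_eq; rewrite addr0.
  apply: DeriveDef; first by apply/derivable1_diffP; exact: differentiable_comp.
  rewrite deriveE; last exact: differentiable_comp.
  by rewrite diff_comp//= diff_val scale1r /partial deriveE.
have [s||s sI E] := @MVT R (fun s => f (x + s *: e_ a))
    (fun s => partial a f (x + s *: e_ a)) 0 t t0.
- by rewrite in_itv/= => /andP[s0 st]; apply: D; rewrite !ltW.
- apply: derivable_within_continuous => s; rewrite in_itv/= => sI.
  by have := D s sI; case.
move: sI; rewrite in_itv/= => /andP[s0 st]; exists s; first by rewrite !ltW.
by move: E; rewrite scale0r addr0 subr0 mulrC.
Qed.

Lemma differentiable_translate f x (c : 'rV[R]_n) :
  differentiable f (x + c) -> differentiable (fun y => f (y + c)) x.
Proof.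
by move=> df; apply: (@differentiable_comp _ _ _ _ (fun y => y + c) f).
Qed.

Lemma partial_translate f a x (c : 'rV[R]_n) :
  partial a (fun y => f (y + c)) x = partial a f (x + c).
Proof.
rewrite /partial /derive.
rewrite (_ : (fun y => f (y + c)) \o shift x = f \o shift (x + c))//.
by apply/funext => h /=; rewrite addrA.
Qed.

(** The mean value theorem is applied along [a] to the increment of [f] along
    [b], and then along [b] to the derivative thus obtained. *)
Lemma second_difference V f a b x (t : R) : smooth_on V f -> 0 < t ->
  (forall s r, 0 <= s <= t -> 0 <= r <= t -> V (x + s *: e_ a + r *: e_ b)) ->
  exists s r, [/\ 0 <= s <= t, 0 <= r <= t &
    f (x + t *: e_ a + t *: e_ b) - f (x + t *: e_ a) - (f (x + t *: e_ b) - f x) =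
    t ^+ 2 * partial b (partial a f) (x + s *: e_ a + r *: e_ b)].
Proof.
move=> sf t0 VI.
have tI : 0 <= t <= t by rewrite lexx ltW.
have oI : 0 <= (0 : R) <= t by rewrite lexx ltW.
have VI0 s : 0 <= s <= t -> V (x + s *: e_ a).
  by move=> sI; have := VI s 0 sI oI; rewrite scale0r addr0.
have d1 s : 0 <= s <= t ->
    differentiable (fun y => f (y + t *: e_ b)) (x + s *: e_ a).
  move=> sI; apply: differentiable_translate.
  exact: smooth_on_differentiable sf (VI _ _ sI tI).
have d2 s : 0 <= s <= t -> differentiable f (x + s *: e_ a).
  by move=> sI; exact: smooth_on_differentiable sf (VI0 _ sI).
have [s sI E] := @partial_MVT (fun y => f (y + t *: e_ b) - f y) a x t t0
  (fun s sI => differentiableB (d1 s sI) (d2 s sI)).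
have [r rI E'] := @partial_MVT (partial a f) b (x + s *: e_ a) t t0
  (fun r rI => smooth_on_differentiable (smooth_on_partial a sf) (VI _ _ sI rI)).
exists s, r; split => //.
rewrite E expr2 -mulrA -E' {1}/partial deriveB; last 2 first.
- by apply: diff_derivable; exact: d1.
- by apply: diff_derivable; exact: d2.
by rewrite -!/(partial _ _ _) partial_translate.
Qed.

Lemma norm_delta_mx_le1 a : `|e_ a| <= 1.
Proof.
rewrite [leLHS]/Num.Def.normr/= mx_normrE; apply: bigmax_le => // -[i j] _.
by rewrite mxE; case: (_ && _); rewrite ?normr1 ?normr0.
Qed.

Lemma dist_half2 (p q m e : R) :
  `|p - m| < e / 2 -> `|q - m| < e / 2 -> `|q - p| <= e.
Proof.
move=> pm qm; rewrite -(subrKA m) (le_trans (ler_normD _ _))//.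
by rewrite (splitr e) lerD// ltW// distrC.
Qed.

(** Schwarz: both mixed partial derivatives are limits of the same second
    difference quotient, which is symmetric in the two directions. *)
Lemma partial_comm V f a b x : open V -> smooth_on V f -> V x ->
  partial a (partial b f) x = partial b (partial a f) x.
Proof.
move=> oV sf Vx; apply/eqP; rewrite -subr_eq0 -normr_le0.
apply/ler_addgt0Pr => e e0; rewrite add0r.
have cont c d : {for x, continuous (partial c (partial d f))}.
  apply: differentiable_continuous; apply: smooth_on_differentiable Vx.
  by do 2!apply: smooth_on_partial.
have e20 : 0 < e / 2 by rewrite divr_gt0.
have near_ c d : \forall y \near x,
    `|partial c (partial d f) x - partial c (partial d f) y| < e / 2.
  by have /cvgrPdist_lt/(_ _ e20) := cont c d.
have nV : nbhs x V by exact: open_nbhs_nbhs.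
have [d /= d0 dP] :=
  (nbhs_ballP _ _).1 (filterI nV (filterI (near_ a b) (near_ b a))).
set t := d / 3.
have t0 : 0 < t by rewrite divr_gt0.
have ballI c c' s r : 0 <= s <= t -> 0 <= r <= t ->
    ball x d (x + s *: e_ c + r *: e_ c').
  move=> /andP[s0 st] /andP[r0 rt].
  rewrite -ball_normE/= opprD opprD addrA addrA subrr sub0r.
  rewrite -opprD normrN (le_lt_trans (ler_normD _ _))//.
  rewrite !normrZ !ger0_norm//.
  have := norm_delta_mx_le1 c; have := norm_delta_mx_le1 c' => c1 c1'.
  apply: (@le_lt_trans _ _ (t + t)); last by rewrite /t; lra.
  by apply: lerD; rewrite -[leRHS]mulr1 ler_pM.
have [s [r [sI rI E]]] := second_difference sf t0
  (fun s r sI rI => (dP _ (ballI a b s r sI rI)).1).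
have [s' [r' [sI' rI' E']]] := second_difference sf t0
  (fun s r sI rI => (dP _ (ballI b a s r sI rI)).1).
have swap (A B C D : R) : A - B - (C - D) = A - C - (B - D) by ring.
have pq : partial b (partial a f) (x + s *: e_ a + r *: e_ b) =
          partial a (partial b f) (x + s' *: e_ b + r' *: e_ a).
  apply: (@mulfI _ (t ^+ 2)); first by rewrite expf_neq0// gt_eqF.
  apply: etrans (esym E) (etrans _ E').
  rewrite [x + t *: e_ b + _]addrAC; exact: swap.
have [_ [_ B1]] := dP _ (ballI a b s r sI rI).
have [_ [B2 _]] := dP _ (ballI b a s' r' sI' rI').
move: B1 B2; rewrite /= -pq; exact: dist_half2.
Qed.

End Calculus.

(** * Covariant derivatives and coordinate forms *)

Section CovariantDerivatives.
Context {R : realType} {n : nat}.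
Implicit Types (G : coefficients R n) (x : 'rV[R]_n) (a b c d : 'I_n).

Lemma cov01E G (w : components R n 0 1) x a b :
  cov G w x [tuple] [tuple a; b] =
  partial a (fun y => w y [tuple] [tuple b]) x -
  \sum_(e < n) G x e a b * w x [tuple] [tuple e].
Proof.
rewrite /cov big_ord0 addr0 big_ord1 theadE.
rewrite (_ : [tuple of behead [tuple a; b]] = [tuple b]); last exact: val_inj.
congr (_ - _); apply: eq_bigr => e _; congr (_ * w x _ _).
by apply: eq_from_tnth => k; rewrite tnth_mktuple ord1 eqxx.
Qed.

Lemma cov02E G (T : components R n 0 2) x a b c :
  cov G T x [tuple] [tuple a; b; c] =
  partial a (fun y => T y [tuple] [tuple b; c]) x -
  \sum_(e < n) G x e a b * T x [tuple] [tuple e; c] -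
  \sum_(e < n) G x e a c * T x [tuple] [tuple b; e].
Proof.
rewrite /cov big_ord0 addr0 2!big_ord_recl big_ord0 addr0 theadE.
rewrite (_ : [tuple of behead [tuple a; b; c]] = [tuple b; c]); last exact: val_inj.
rewrite opprD addrA; congr (_ - _ - _); apply: eq_bigr => e _; congr (_ * T x _ _).
  by apply: eq_from_tnth => -[[|[|//]] k]; rewrite tnth_mktuple.
by apply: eq_from_tnth => -[[|[|//]] k]; rewrite tnth_mktuple.
Qed.

Lemma eq_cov r s G G' (T : components R n r s) x U L :
  (forall c a b, G x c a b = G' x c a b) -> cov G T x U L = cov G' T x U L.
Proof.
move=> GG'; rewrite /cov; congr (_ + _ - _).
  by apply: eq_bigr => k _; apply: eq_bigr => e _; rewrite GG'.
by apply: eq_bigr => k _; apply: eq_bigr => e _; rewrite GG'.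
Qed.

Lemma big_tuple0 (F : 0.-tuple 'I_n -> R) : \sum_A F A = F [tuple].
Proof. by apply: big_pred1 => A; apply/esym/eqP; exact: tuple0. Qed.

Lemma big_tuple1 (F : 1.-tuple 'I_n -> R) : \sum_A F A = \sum_(b < n) F [tuple b].
Proof.
rewrite (reindex (fun b => [tuple b])) //; exists (@thead _ _) => [b _|A _] //.
by case/tupleP: A => b A; rewrite tuple0 theadE; exact: val_inj.
Qed.

End CovariantDerivatives.

Section CoordinateForms.
Context {R : realType} {n : nat} (M : manifold R n).
Implicit Types (i j k : chart M) (x : 'rV[R]_n).

Lemma near_chart i (W : set M) x : open W -> cod i x -> W (psi i x) ->
  \forall z \near x, cod i z /\ W (psi i z).
Proof.
move=> oW ix Wx; near=> z; split.
  by near: z; apply: open_nbhs_nbhs; split => //; exact: cod_open.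
near: z.
have := @psi_continuous _ _ M i; rewrite continuous_open_subspace; last exact: cod_open.
by move=> /(_ x); rewrite inE => /(_ ix); apply; exact: open_nbhs_nbhs.
Unshelve. all: by end_near. Qed.

Lemma transition_comp i j k x : cod i x -> dom j (psi i x) ->
  \forall z \near x, transition j k (transition i j z) = transition i k z.
Proof.
move=> ix jx; apply: filterS (near_chart (@dom_open _ _ M j) ix jx) => z [iz jz].
by rewrite /transition phiK.
Qed.

Lemma jac_comp i j k x d a : cod i x -> dom j (psi i x) -> dom k (psi i x) ->
  jac i k x d a =
  \sum_(b < n) jac j k (transition i j x) d b * jac i j x b a.
Proof.
move=> ix jx kx; rewrite /jac.
rewrite -(@partial_comp _ _ (transition i j) (transition j k)
   (fun z => transition j k z 0 d) a x).
- apply: near_eq_derive; apply: filterS (transition_comp k ix jx) => z /= -> //.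
- by move=> b; apply: smooth_on_differentiable (@transition_smooth _ _ M i j b) _.
- apply: smooth_on_differentiable (@transition_smooth _ _ M j k d) _.
  by rewrite /transition /= phiK//; split => //; exact: phi_cod.
Qed.

Lemma jac_id i x c a : cod i x -> jac i i x c a = (c == a)%:R.
Proof.
move=> ix; rewrite /jac -(partial_coord c a x); apply: near_eq_derive.
near=> z; rewrite /transition psiK//; near: z; apply: open_nbhs_nbhs.
by split => //; exact: cod_open.
Unshelve. all: by end_near. Qed.

(** The differential of a coordinate function is only defined on the domain of
    its chart, but has components in every chart: its transformation law is the
    chain rule. *)
Definition coordinate_form i (d : 'I_n) : tensor_field (dom i) 0 1.
Proof.
refine (@TensorField R n M (dom i) 0 1 (fun j x _ L => jac j i x d (thead L)) _ _).
- move=> j U L; apply: smooth_on_partial.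
  exact: (@transition_smooth _ _ M j i d).
- move=> j k x U L jx kx ix.
  rewrite big_tuple0 big_ord0 mul1r big_tuple1 (jac_comp d _ jx kx ix).
  by apply: eq_bigr => b _; rewrite big_ord1 !theadE (tnth_nth b).
Defined.

End CoordinateForms.

(** * A quadratic identity in four dimensions *)

Section FourDimensions.
Context {R : realFieldType}.

Let o0 : 'I_4 := ord0.
Let o1 : 'I_4 := lift ord0 ord0.
Let o2 : 'I_4 := lift ord0 (lift ord0 ord0).
Let o3 : 'I_4 := lift ord0 (lift ord0 (lift ord0 ord0)).

Lemma sum4 (F : 'I_4 -> R) : \sum_i F i = F o0 + F o1 + F o2 + F o3.
Proof. by rewrite !big_ord_recl big_ord0 addr0 !addrA. Qed.

Lemma ord4_ind (P : 'I_4 -> Prop) : P o0 -> P o1 -> P o2 -> P o3 -> forall i, P i.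
Proof.
move=> P0 P1 P2 P3 [[|[|[|[|//]]]] i4].
- by rewrite (_ : Ordinal i4 = o0) //; apply: val_inj.
- by rewrite (_ : Ordinal i4 = o1) //; apply: val_inj.
- by rewrite (_ : Ordinal i4 = o2) //; apply: val_inj.
- by rewrite (_ : Ordinal i4 = o3) //; apply: val_inj.
Qed.

(** Trace-freeness identifies, up to sign, the component of [M] at the pairs P
    and Q with its component at the complements of Q and P.  For P <> Q meeting
    in one index this is one of the off-diagonal traces, which have two terms;
    for P = Q it follows from the four diagonal traces.  Under these relations
    the partial traces of the square of [M] become multiples of the identity. *)
Lemma weyl_quadratic (M : 'I_4 -> 'I_4 -> 'I_4 -> 'I_4 -> R) e f :
  (forall a b c d, M b a c d = - M a b c d) ->
  (forall a b c d, M a b d c = - M a b c d) ->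
  (forall a c, \sum_b M a b c b = 0) ->
  \sum_b \sum_c \sum_d M f b c d * M c d e b =
  (f == e)%:R / 4 * \sum_a \sum_b \sum_c \sum_d M a b c d * M c d a b.
Proof.
move=> Ml Mr Mt.
have M0l a c d : M a a c d = 0 by have := Ml a a c d; lra.
have M0r a b c : M a b c c = 0 by have := Mr a b c c; lra.
pose Mrr c d a b := Mr a b c d.
have antisymE := (M0l, M0r, (Ml o0 o1, Ml o0 o2, Ml o0 o3, Ml o1 o2, Ml o1 o3,
  Ml o2 o3), (Mrr o0 o1, Mrr o0 o2, Mrr o0 o3, Mrr o1 o2, Mrr o1 o3, Mrr o2 o3)).
have T a c : M a o0 c o0 + M a o1 c o1 + M a o2 c o2 + M a o3 c o3 = 0.
  by have := Mt a c; rewrite sum4.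
(* The diagonal traces. *)
have d1 : M o2 o3 o2 o3 = M o0 o1 o0 o1.
  by have := T o0 o0; have := T o1 o1; have := T o2 o2; have := T o3 o3;
     rewrite !antisymE => ? ? ? ?; lra.
have d2 : M o1 o3 o1 o3 = M o0 o2 o0 o2.
  by have := T o0 o0; have := T o1 o1; have := T o2 o2; have := T o3 o3;
     rewrite !antisymE => ? ? ? ?; lra.
have d3 : M o1 o2 o1 o2 = M o0 o3 o0 o3.
  by have := T o0 o0; have := T o1 o1; have := T o2 o2; have := T o3 o3;
     rewrite !antisymE => ? ? ? ?; lra.
(* The trace of indices a and c gives [eac]. *)
have e01 : M o0 o2 o1 o2 = - M o0 o3 o1 o3.
  by have := T o0 o1; rewrite !antisymE => ?; lra.
have e10 : M o1 o2 o0 o2 = - M o1 o3 o0 o3.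
  by have := T o1 o0; rewrite !antisymE => ?; lra.
have e02 : M o0 o1 o1 o2 = M o0 o3 o2 o3.
  by have := T o0 o2; rewrite !antisymE => ?; lra.
have e20 : M o1 o2 o0 o1 = M o2 o3 o0 o3.
  by have := T o2 o0; rewrite !antisymE => ?; lra.
have e03 : M o0 o1 o1 o3 = - M o0 o2 o2 o3.
  by have := T o0 o3; rewrite !antisymE => ?; lra.
have e30 : M o1 o3 o0 o1 = - M o2 o3 o0 o2.
  by have := T o3 o0; rewrite !antisymE => ?; lra.
have e12 : M o0 o1 o0 o2 = - M o1 o3 o2 o3.
  by have := T o1 o2; rewrite !antisymE => ?; lra.
have e21 : M o0 o2 o0 o1 = - M o2 o3 o1 o3.
  by have := T o2 o1; rewrite !antisymE => ?; lra.
have e13 : M o0 o1 o0 o3 = M o1 o2 o2 o3.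
  by have := T o1 o3; rewrite !antisymE => ?; lra.
have e31 : M o0 o3 o0 o1 = M o2 o3 o1 o2.
  by have := T o3 o1; rewrite !antisymE => ?; lra.
have e23 : M o0 o2 o0 o3 = - M o1 o2 o1 o3.
  by have := T o2 o3; rewrite !antisymE => ?; lra.
have e32 : M o0 o3 o0 o2 = - M o1 o3 o1 o2.
  by have := T o3 o2; rewrite !antisymE => ?; lra.
have dualE := (d1, d2, d3, (e01, e10, e02, e20, e03, e30),
  (e12, e21, e13, e31, e23, e32)).
pose S f e := \sum_b \sum_c \sum_d M f b c d * M c d e b.
(* Both factors are antisymmetric in c and d, so that six pairs suffice. *)
have S2 f' e' : S f' e' = 2 * \sum_b (M f' b o0 o1 * M o0 o1 e' b +
    M f' b o0 o2 * M o0 o2 e' b + M f' b o0 o3 * M o0 o3 e' b +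
    M f' b o1 o2 * M o1 o2 e' b + M f' b o1 o3 * M o1 o3 e' b +
    M f' b o2 o3 * M o2 o3 e' b).
  rewrite mulr_sumr; apply: eq_bigr => b _; rewrite !sum4 !antisymE; ring.
have SE f' e' : S f' e' = (f' == e')%:R * S o0 o0.
  rewrite !S2 !sum4 !(M0l o0) !(M0r _ _ o0).
  by move: f' e'; apply: ord4_ind; apply: ord4_ind;
     rewrite !antisymE !dualE /=; ring.
rewrite -/(S f e) -[X in _ / 4 * X]/(\sum_a S a a) sum4 (SE f e).
rewrite (SE o1) (SE o2) (SE o3) !eqxx /=.
by field.
Qed.

End FourDimensions.

(** * The curvature of a Levi-Civita connection *)

Section Contractions.
Context {R : comNzRingType} {n : nat}.
Implicit Types (F X Y : 'I_n -> R) (u : 'I_n -> 'I_n -> R).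

Lemma sum_deltal F d : \sum_(e < n) (d == e)%:R * F e = F d.
Proof.
rewrite (bigD1 d)//= eqxx mul1r big1 ?addr0// => e ed.
by rewrite eq_sym (negbTE ed) mul0r.
Qed.

Lemma sum_deltar F d : \sum_(e < n) F e * (d == e)%:R = F d.
Proof. by rewrite -[RHS]sum_deltal; apply: eq_bigr => e _; rewrite mulrC. Qed.

Lemma sum_deltar_sym F d : \sum_(e < n) F e * (e == d)%:R = F d.
Proof. by rewrite -[RHS]sum_deltar; apply: eq_bigr => e _; rewrite eq_sym. Qed.

Lemma sum_deltal_sym F d : \sum_(e < n) (e == d)%:R * F e = F d.
Proof. by rewrite -[RHS]sum_deltal; apply: eq_bigr => e _; rewrite eq_sym. Qed.

(** Moving a raised index from one factor of a contraction to the other. *)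
Lemma sum_raise u X Y : (forall a b, u a b = u b a) ->
  \sum_a (\sum_b u a b * X b) * Y a = \sum_a X a * \sum_b u a b * Y b.
Proof.
move=> uC; under eq_bigr do rewrite mulr_suml.
rewrite exchange_big/=; apply: eq_bigr => a _; rewrite mulr_sumr.
by apply: eq_bigr => b _; rewrite uC; ring.
Qed.

Lemma sum_raise_rev u X Y : (forall a b, u a b = u b a) ->
  \sum_a X a * (\sum_b u a b * Y b) = \sum_a (\sum_b u a b * X b) * Y a.
Proof. by move=> uC; rewrite sum_raise. Qed.

End Contractions.

Definition riemann_lo (R : realType) (n : nat) (g : components R n 0 2)
    (G : coefficients R n) (x : 'rV[R]_n) (a b c d : 'I_n) : R :=
  \sum_e riemann G x a b c e * lo g x e d.

Section LeviCivita.
Context {R : realType} {n : nat}.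

(** A metric and its Levi-Civita connection in one chart, with the
    compatibility condition solved for the derivatives of the metric. *)
Record levi_civita_on (V : set 'rV[R]_n) (g : components R n 0 2)
    (G : coefficients R n) : Prop := LeviCivitaOn {
  lc_open : open V;
  lc_smooth : forall a b, smooth_on V (fun y => lo g y a b);
  lc_coef_smooth : forall c a b, smooth_on V (fun y => G y c a b);
  lc_unit : forall y, V y -> \matrix_(c, d) lo g y c d \in unitmx;
  lc_sym : forall y a b, V y -> lo g y a b = lo g y b a;
  lc_torsion_free : forall y c a b, V y -> G y c a b = G y c b a;
  lc_compat : forall y m a b, V y -> partial m (fun z => lo g z a b) y =
    \sum_e G y e m a * lo g y e b + \sum_e G y e m b * lo g y a e
}.

Context {V : set 'rV[R]_n} {g : components R n 0 2} {G : coefficients R n}.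
Hypothesis LC : levi_civita_on V g G.
Implicit Types (x : 'rV[R]_n) (a b c d e m p : 'I_n).

Local Notation h := (lo g).
Local Notation oV := (lc_open LC).

Lemma sum_up_lo x a b : V x -> \sum_e up g x a e * h x e b = (a == b)%:R.
Proof.
move=> Vx; have := mulVmx (lc_unit LC Vx) => /matrixP/(_ a b); rewrite !mxE => <-.
by apply: eq_bigr => e _; rewrite [in RHS]mxE.
Qed.

Lemma up_sym x a b : V x -> up g x a b = up g x b a.
Proof.
move=> Vx; have hT : (\matrix_(c, d) h x c d)^T = \matrix_(c, d) h x c d.
  by apply/matrixP => i j; rewrite !mxE (lc_sym LC).
by rewrite /up -{1}hT -trmx_inv mxE.
Qed.

Lemma sum_lo_up x a b : V x -> \sum_e h x a e * up g x e b = (a == b)%:R.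
Proof.
move=> Vx; rewrite eq_sym -(sum_up_lo _ _ Vx); apply: eq_bigr => e _.
by rewrite mulrC up_sym// (lc_sym LC).
Qed.

Lemma raise_lower x (X : 'I_n -> R) a : V x ->
  \sum_b up g x a b * (\sum_e h x b e * X e) = X a.
Proof.
move=> Vx; under eq_bigr do rewrite mulr_sumr.
rewrite exchange_big/= -[RHS](sum_deltal X); apply: eq_bigr => e _.
by rewrite -(sum_up_lo _ _ Vx) mulr_suml; apply: eq_bigr => b _; rewrite mulrA.
Qed.

Lemma lower_raise x (X : 'I_n -> R) a : V x ->
  \sum_b h x a b * (\sum_e up g x b e * X e) = X a.
Proof.
move=> Vx; under eq_bigr do rewrite mulr_sumr.
rewrite exchange_big/= -[RHS](sum_deltal X); apply: eq_bigr => e _.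
by rewrite -(sum_lo_up _ _ Vx) mulr_suml; apply: eq_bigr => b _; rewrite mulrA.
Qed.

Lemma smooth_up a b : smooth_on V (fun y => up g y a b).
Proof.
by apply: smooth_on_invmx; [exact: oV | exact: (lc_unit LC) | exact: (lc_smooth LC)].
Qed.

Lemma riemannE x a b c d : V x ->
  riemann G x a b c d =
  partial b (fun y => G y d a c) x - partial a (fun y => G y d b c) x
  + \sum_e G x e a c * G x d b e - \sum_e G x e b c * G x d a e.
Proof.
move=> Vx; rewrite /riemann.
have -> : cov G (@coordinate_covector R n d) =
    (fun y _ L => - G y d (thead L) (thead [tuple of behead L])).
  apply/funext => y; apply/funext => U; apply/funext => L.
  rewrite (tuple0 U); case/tupleP: L => b' L; case/tupleP: L => c' L.
  rewrite (tuple0 L) [LHS]cov01E partial_cst sub0r; congr (- _).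
  rewrite -[RHS](sum_deltar (fun e => G y e b' c')).
  by apply: eq_bigr => e _; rewrite /coordinate_covector theadE eq_sym.
have covE a' b' c' : cov G (fun y _ L => - G y d (thead L) (thead [tuple of behead L])) x
      [tuple] [tuple a'; b'; c'] =
    - partial a' (fun y => G y d b' c') x + \sum_e G x e a' b' * G x d e c'
    + \sum_e G x e a' c' * G x d b' e.
  rewrite cov02E -(partialN _ (lc_coef_smooth LC d b' c') Vx) -!sumrN.
  by congr (_ + _ + _); apply: eq_bigr => e _; rewrite mulrN opprK.
rewrite !covE.
have -> : \sum_e G x e b a * G x d e c = \sum_e G x e a b * G x d e c.
  by apply: eq_bigr => e _; rewrite (lc_torsion_free LC _ b).
ring.
Qed.

Lemma riemann_antisym x a b c d : riemann G x b a c d = - riemann G x a b c d.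
Proof. by rewrite /riemann [RHS]opprB. Qed.

Lemma riemann_bianchi x a b c d : V x ->
  riemann G x a b c d + riemann G x b c a d + riemann G x c a b d = 0.
Proof.
move=> Vx; rewrite !riemannE//.
have dC a' b' c' : partial a' (fun y => G y d b' c') x =
    partial a' (fun y => G y d c' b') x.
  apply: (@eq_partial _ _ V) => //; first exact: oV.
  move=> y Vy; exact: (lc_torsion_free LC d b' c' Vy).
have GC a' b' c' : \sum_e G x e a' c' * G x d b' e = \sum_e G x e c' a' * G x d b' e.
  by apply: eq_bigr => e _; rewrite (lc_torsion_free LC _ a').
rewrite (dC a c b) (dC b c a) (dC c b a) (GC a b c) (GC b a c) (GC a c b).
ring.
Qed.

(** The second derivatives of the metric commute, so the curvature annihilates
    the metric. *)
Lemma riemann_lo_antisym x a b c d : V x ->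
  riemann_lo g G x a b d c = - riemann_lo g G x a b c d.
Proof.
move=> Vx.
pose Q a b c d := \sum_e (partial a (fun y => G y e b c) x * h x e d +
                          G x e b c * partial a (fun y => h y e d) x).
pose Y a c b d := \sum_e \sum_f G x e a c * G x f b d * h x e f.
have ddh a' b' c' d' : partial a' (partial b' (fun y => h y c' d')) x =
    Q a' b' c' d' + Q a' b' d' c'.
  rewrite (@eq_partial _ _ V _ (fun y =>
     \sum_e G y e b' c' * h y e d' + \sum_e G y e b' d' * h y e c'))//; last 2 first.
  - exact: oV.
  - move=> y Vy; rewrite (lc_compat LC)//; congr (_ + _).
    by apply: eq_bigr => e _; rewrite (lc_sym LC _ e).
  have sT i j e k : smooth_on V (fun y => G y e i j * h y e k).
    apply: smooth_onM; first exact: oV.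
      exact: lc_coef_smooth LC _ _ _.
    exact: lc_smooth LC _ _.
  have sS i j k : smooth_on V (fun y => \sum_e G y e i j * h y e k).
    by apply: smooth_on_sum; [exact: oV | move=> e; exact: sT].
  rewrite (partialD _ (sS _ _ _) (sS _ _ _) Vx).
  rewrite !(partial_sum _ _ Vx); last 2 first.
  - by move=> e; exact: sT.
  - by move=> e; exact: sT.
  congr (_ + _); apply: eq_bigr => e _;
    exact: partialM (lc_coef_smooth LC _ _ _) (lc_smooth LC _ _) Vx.
have RE a' b' c' d' : riemann_lo g G x a' b' c' d' =
    Q b' a' c' d' - Q a' b' c' d' - Y a' c' b' d' + Y b' c' a' d'.
  have QE i j k l : Q i j k l = \sum_e partial i (fun y => G y e j k) x * h x e l +
      \sum_e (\sum_f G x f j k * G x e i f) * h x e l + Y j k i l.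
    rewrite /Q big_split/= -addrA; congr (_ + _).
    under eq_bigr do rewrite (lc_compat LC)// mulrDr.
    rewrite big_split/=; congr (_ + _).
      under eq_bigr do rewrite mulr_sumr.
      rewrite exchange_big/=; apply: eq_bigr => f _; rewrite mulr_suml.
      by apply: eq_bigr => e _; rewrite mulrA.
    apply: eq_bigr => e _; rewrite mulr_sumr.
    by apply: eq_bigr => f _; rewrite mulrA.
  rewrite !QE /riemann_lo.
  under eq_bigr do rewrite riemannE// !(mulrDl, mulNr).
  rewrite !big_split/= !sumrN; ring.
have YC a' c' b' d' : Y a' c' b' d' = Y b' d' a' c'.
  rewrite /Y exchange_big/=; apply: eq_bigr => e _; apply: eq_bigr => f _.
  by rewrite (lc_sym LC _ e)//; ring.
apply/eqP; rewrite -addr_eq0; apply/eqP; rewrite !RE.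
have := partial_comm a b oV (lc_smooth LC c d) Vx; rewrite !ddh.
rewrite (YC a d b c) (YC b d a c) => E.
move: E; move: (Q a b c d) (Q a b d c) (Q b a c d) (Q b a d c).
by move: (Y _ _ _ _) (Y _ _ _ _) => y1 y2 q1 q2 q3 q4; lra.
Qed.

End LeviCivita.

Section PairSymmetry.
Context {R : realType} {n : nat}.

(** The four cyclic identities, one for each choice of the last index, combine
    with signs + + - - so that only the two sides remain. *)
Lemma pair_symmetry (X : 'I_n -> 'I_n -> 'I_n -> 'I_n -> R) a b c d :
  (forall a b c d, X b a c d = - X a b c d) ->
  (forall a b c d, X a b d c = - X a b c d) ->
  (forall a b c d, X a b c d + X b c a d + X c a b d = 0) ->
  X a b c d = X c d a b.
Proof.
move=> Xl Xr Xb.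
have := Xb a b c d; have := Xb b c d a; have := Xb c d a b; have := Xb d a b c.
have := (Xr b c a d, Xr c d a b, Xl b d c a, Xl a d c b, Xr a d b c).
have := (Xl c a d b, Xr c a b d, Xl a d b c, Xr a b c d, Xr b d c a).
by do 2!case=> [[[[? ?] ?] ?] ?]; move=> ? ? ? ?; lra.
Qed.

End PairSymmetry.

Section Curvature.
Context {R : realType} {n : nat}.
Context {V : set 'rV[R]_n} {g : components R n 0 2} {G : coefficients R n}.
Hypothesis LC : levi_civita_on V g G.
Implicit Types (x : 'rV[R]_n) (a b c d e m p : 'I_n).

Local Notation h := (lo g).
Local Notation oV := (lc_open LC).

Lemma riemann_lo_pair x a b c d : V x ->
  riemann_lo g G x a b c d = riemann_lo g G x c d a b.
Proof.
move=> Vx; apply: (@pair_symmetry _ _ (riemann_lo g G x)) => a' b' c' d'.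
- by rewrite /riemann_lo -sumrN; apply: eq_bigr => e _; rewrite riemann_antisym mulNr.
- by rewrite (riemann_lo_antisym LC).
- rewrite /riemann_lo -!big_split/= big1// => e _.
  by rewrite -!mulrDl (riemann_bianchi LC)// mul0r.
Qed.

Lemma riemann_raise x a b c d : V x ->
  riemann G x a b c d = \sum_e up g x d e * riemann_lo g G x a b c e.
Proof.
move=> Vx; rewrite -[LHS](raise_lower LC (fun d => riemann G x a b c d) d Vx).
apply: eq_bigr => e _; congr (_ * _); apply: eq_bigr => f _.
by rewrite mulrC (lc_sym LC).
Qed.

Lemma ricci_sym x a c : V x -> ricci G x a c = ricci G x c a.
Proof.
move=> Vx; rewrite /ricci; under eq_bigr do rewrite riemann_raise//.
under [RHS]eq_bigr do rewrite riemann_raise//.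
rewrite exchange_big/=; apply: eq_bigr => b _; apply: eq_bigr => e _.
by rewrite (up_sym LC)// riemann_lo_pair.
Qed.

(** The commutator of two covariant derivatives of a covector field; the terms
    that are symmetric for a connection without torsion are left out. *)
Lemma ricci_identity (w : 'I_n -> 'rV[R]_n -> R)
    (N := fun a b y => partial a (w b) y - \sum_e G y e a b * w e y) x a b c :
  (forall a, smooth_on V (w a)) -> V x ->
  partial a (N b c) x - partial b (N a c) x
  - \sum_e G x e a c * N b e x + \sum_e G x e b c * N a e x =
  \sum_e riemann G x a b c e * w e x.
Proof.
move=> sw Vx.
have sGw i j e : smooth_on V (fun y => G y e i j * w e y).
  by apply: smooth_onM; [exact: oV | exact: (lc_coef_smooth LC) | exact: sw].
have dN i j k : partial i (N j k) x = partial i (partial j (w k)) x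
    - \sum_e partial i (fun y => G y e j k) x * w e x
    - \sum_e G x e j k * partial i (w e) x.
  rewrite /N (partialB _ (smooth_on_partial _ (sw _)) _ Vx); last first.
    by apply: smooth_on_sum => //; exact: oV.
  rewrite (partial_sum _ _ Vx)// -addrA -opprD -big_split/=; congr (_ - _).
  by apply: eq_bigr => e _; exact: partialM (lc_coef_smooth LC _ _ _) (sw _) Vx.
have SN i j k : \sum_e G x e i k * N j e x = \sum_e G x e i k * partial j (w e) x
    - \sum_e (\sum_f G x f i k * G x e j f) * w e x.
  rewrite -sumrB /N.
  under eq_bigr do rewrite mulrBr.
  rewrite !sumrB; congr (_ - _).
  under eq_bigr do rewrite mulr_sumr.
  rewrite exchange_big/=; apply: eq_bigr => f _; rewrite mulr_suml.
  by apply: eq_bigr => e _; rewrite mulrA.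
rewrite !dN !SN (partial_comm a b oV (sw c) Vx).
under [RHS]eq_bigr do rewrite (riemannE LC)// !(mulrDl, mulNr).
rewrite !big_split/= !sumrN; ring.
Qed.

End Curvature.

(** * The Weyl tensor *)

(** C_{ab}^{cd}: with two indices of each kind, traces and squares are taken
    without the metric. *)
Definition weyl_mixed (R : realType) (g : components R 4 0 2)
    (G : coefficients R 4) (x : 'rV[R]_4) (a b c d : 'I_4) : R :=
  \sum_e up g x c e * weyl g G x a b e d.

Section Weyl.
Context {R : realType}.
Context {V : set 'rV[R]_4} {g : components R 4 0 2} {G : coefficients R 4}.
Hypothesis LC : levi_civita_on V g G.
Implicit Types (x : 'rV[R]_4) (a b c d e m p : 'I_4).

Local Notation h := (lo g).
Local Notation L := (lo (schouten g G)).
Local Notation oV := (lc_open LC).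

Lemma schoutenE x a b :
  L x a b = 2^-1 * (ricci G x a b - 6^-1 * scalar_curvature g G x * h x a b).
Proof. by []. Qed.

Lemma schouten_sym x a b : V x -> L x a b = L x b a.
Proof.
by move=> Vx; rewrite !schoutenE (ricci_sym LC)// (lc_sym LC).
Qed.

Lemma schouten_mixed_lower x a b : V x ->
  \sum_e h x a e * schouten_mixed g G x e b = L x a b.
Proof. by move=> Vx; exact: (lower_raise LC (fun e => L x e b)). Qed.

Lemma weylE x a b c d : weyl g G x a b c d =
  riemann G x a b c d
  - (schouten_mixed g G x d b * h x a c - schouten_mixed g G x d a * h x b c)
  - ((d == b)%:R * L x a c - (d == a)%:R * L x b c).
Proof. by rewrite /weyl /asym; field. Qed.

Lemma weyl_loE x a b c d : V x -> weyl_lo g G x a b c d =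
  riemann_lo g G x a b c d - (L x d b * h x a c - L x d a * h x b c)
  - (h x b d * L x a c - h x a d * L x b c).
Proof.
move=> Vx.
have SL i : L x d i = \sum_e schouten_mixed g G x e i * h x e d.
  rewrite -schouten_mixed_lower//; apply: eq_bigr => e _.
  by rewrite mulrC (lc_sym LC).
have hE i : h x i d = \sum_e (e == i)%:R * h x e d by rewrite sum_deltal_sym.
rewrite /weyl_lo !SL (hE a) (hE b) /riemann_lo !mulr_suml -!sumrB.
by apply: eq_bigr => e _; rewrite weylE; ring.
Qed.

Lemma weyl_antisym x a b c d : weyl g G x b a c d = - weyl g G x a b c d.
Proof. by rewrite !weylE riemann_antisym; ring. Qed.

Lemma weyl_lo_antisym x a b c d : V x ->
  weyl_lo g G x a b d c = - weyl_lo g G x a b c d.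
Proof.
move=> Vx; rewrite !weyl_loE// (riemann_lo_antisym LC)//.
rewrite (schouten_sym d b)// (schouten_sym d a)//.
rewrite (schouten_sym c b)// (schouten_sym c a)//.
ring.
Qed.

Lemma weyl_lo_pair x a b c d : V x ->
  weyl_lo g G x a b c d = weyl_lo g G x c d a b.
Proof.
move=> Vx; apply: (@pair_symmetry _ _ (weyl_lo g G x)) => a' b' c' d'.
- by rewrite /weyl_lo -sumrN; apply: eq_bigr => e _; rewrite weyl_antisym mulNr.
- exact: weyl_lo_antisym.
- have : riemann_lo g G x a' b' c' d' + riemann_lo g G x b' c' a' d' +
      riemann_lo g G x c' a' b' d' = 0.
    rewrite /riemann_lo -!big_split/= big1// => e _.
    by rewrite -!mulrDl (riemann_bianchi LC)// mul0r.
  rewrite !weyl_loE// => E.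
  rewrite -[RHS]E (schouten_sym d' b')// (schouten_sym d' a')// (schouten_sym d' c')//.
  rewrite (schouten_sym b' a')// (schouten_sym c' a')// (schouten_sym c' b')//.
  rewrite (lc_sym LC b' a' Vx) (lc_sym LC c' a' Vx) (lc_sym LC c' b' Vx).
  ring.
Qed.

Lemma sum_up_loT x : V x -> \sum_a \sum_b up g x a b * h x a b = 4.
Proof.
move=> Vx; rewrite (eq_bigr (fun=> 1)); first by rewrite sumr_const card_ord.
move=> a _; transitivity ((a == a)%:R : R); last by rewrite eqxx.
rewrite -(sum_up_lo LC _ _ Vx); apply: eq_bigr => b _.
by rewrite (lc_sym LC).
Qed.

(** The Schouten tensor is the tensor that makes the Weyl tensor trace-free. *)
Lemma weyl_trace x a c : V x -> \sum_b weyl g G x a b c b = 0.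
Proof.
move=> Vx; under eq_bigr do rewrite weylE.
have tr : \sum_b schouten_mixed g G x b b = 6^-1 * scalar_curvature g G x.
  transitivity (2^-1 * (\sum_a \sum_b up g x a b * ricci G x a b -
      6^-1 * scalar_curvature g G x *
      \sum_a \sum_b up g x a b * h x a b)); last first.
    by rewrite sum_up_loT// -/(scalar_curvature g G x); field.
  rewrite mulr_sumr -sumrB mulr_sumr; apply: eq_bigr => b _.
  rewrite mulr_sumr -sumrB mulr_sumr; apply: eq_bigr => e _.
  rewrite -/(lo (schouten g G) x e b) (schouten_sym e b)// schoutenE; ring.
have sumE (F1 F2 F3 F4 F5 : 'I_4 -> R) :
    \sum_b (F1 b - (F2 b - F3 b) - (F4 b - F5 b)) =
    \sum_b F1 b - (\sum_b F2 b - \sum_b F3 b) - (\sum_b F4 b - \sum_b F5 b).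
  by rewrite !sumrB.
rewrite (sumE (fun b => riemann G x a b c b)) -!mulr_suml tr.
have -> : \sum_b schouten_mixed g G x b a * h x b c = L x a c.
  rewrite schouten_sym// -schouten_mixed_lower//; apply: eq_bigr => e _.
  by rewrite mulrC (lc_sym LC).
rewrite sum_deltal_sym.
have -> : \sum_(i < 4) (i == i)%:R = 4 :> R.
  by rewrite (eq_bigr (fun=> 1)) ?sumr_const ?card_ord// => i _; rewrite eqxx.
by rewrite -/(ricci G x a c) schoutenE; field.
Qed.

Lemma weyl_raise x a b c d : V x ->
  weyl g G x a b c d = \sum_e up g x d e * weyl_lo g G x a b c e.
Proof.
move=> Vx; rewrite -[LHS](raise_lower LC (weyl g G x a b c) d Vx).
apply: eq_bigr => e _; congr (_ * _); apply: eq_bigr => f _.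
by rewrite mulrC (lc_sym LC).
Qed.

Lemma weyl_mixedE x a b c d : V x -> weyl_mixed g G x a b c d =
  \sum_e \sum_f up g x c e * up g x d f * weyl_lo g G x a b e f.
Proof.
move=> Vx; apply: eq_bigr => e _; rewrite weyl_raise// mulr_sumr.
by apply: eq_bigr => f _; rewrite mulrA.
Qed.

Lemma weyl_mixed_antisyml x a b c d :
  weyl_mixed g G x b a c d = - weyl_mixed g G x a b c d.
Proof. by rewrite -sumrN; apply: eq_bigr => e _; rewrite weyl_antisym mulrN. Qed.

Lemma weyl_mixed_antisymr x a b c d : V x ->
  weyl_mixed g G x a b d c = - weyl_mixed g G x a b c d.
Proof.
move=> Vx; rewrite !weyl_mixedE// exchange_big/= -sumrN; apply: eq_bigr => e _.
rewrite -sumrN; apply: eq_bigr => f _; rewrite weyl_lo_antisym//; ring.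
Qed.

Lemma weyl_mixed_trace x a c : V x -> \sum_b weyl_mixed g G x a b c b = 0.
Proof.
move=> Vx; rewrite exchange_big/= big1// => e _.
by rewrite -mulr_sumr weyl_trace// mulr0.
Qed.

Lemma weyl_up3E x d a m p : V x ->
  weyl_up3 g G x d a m p = \sum_b up g x a b * weyl_mixed g G x d b m p.
Proof.
move=> Vx; apply: eq_bigr => b _; rewrite weyl_mixedE// mulr_sumr.
apply: eq_bigr => e _; rewrite mulr_sumr; apply: eq_bigr => f _; ring.
Qed.

(** Raising and lowering exchanges the index pairs of one factor; the pair
    symmetry of the Weyl tensor puts them back. *)
Lemma weyl_sqE x : V x -> weyl_sq g G x =
  \sum_a \sum_b \sum_c \sum_d weyl_mixed g G x a b c d * weyl_mixed g G x c d a b.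
Proof.
move=> Vx; rewrite /weyl_sq.
have upC a b := up_sym LC a b Vx.
have exch (F : 'I_4 -> 'I_4 -> 'I_4 -> 'I_4 -> R) :
    \sum_a \sum_b \sum_c \sum_d F a b c d = \sum_c \sum_d \sum_a \sum_b F a b c d.
  under eq_bigr do rewrite exchange_big/=.
  rewrite exchange_big/=; apply: eq_bigr => c _.
  under eq_bigr do rewrite exchange_big/=.
  by rewrite exchange_big.
rewrite exch [RHS]exch; apply: eq_bigr => c _; apply: eq_bigr => d _.
transitivity (\sum_a \sum_b weyl_lo g G x a b c d *
    \sum_e up g x a e * \sum_f up g x b f * weyl_mixed g G x e f c d).
  apply: eq_bigr => a _; apply: eq_bigr => b _; congr (_ * _).
  by apply: eq_bigr => e _; rewrite weyl_up3E.
rewrite exchange_big/=.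
under eq_bigr do rewrite (sum_raise_rev _ _ upC).
rewrite exchange_big/=; apply: eq_bigr => a _.
transitivity (\sum_b (\sum_e up g x a e * weyl_lo g G x e b c d) *
   (\sum_f up g x b f * weyl_mixed g G x a f c d)) => //.
rewrite (sum_raise_rev _ _ upC); apply: eq_bigr => b _; rewrite mulrC; congr (_ * _).
rewrite weyl_mixedE// exchange_big/=; apply: eq_bigr => f _; rewrite mulr_sumr.
by apply: eq_bigr => e _; rewrite (weyl_lo_pair _ _ c)//; ring.
Qed.

(** Shifting the raised indices between the factors leads to the mixed form of
    the Weyl tensor, which satisfies the hypotheses of [weyl_quadratic].  The
    sign comes from the exchange of the last two indices of one factor. *)
Lemma weyl_up3_weyl x d e : V x ->
  \sum_a \sum_m \sum_p weyl_up3 g G x d a m p * weyl g G x m p a e =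
  - ((d == e)%:R / 4 * weyl_sq g G x).
Proof.
move=> Vx; have upC a b := up_sym LC a b Vx.
have Ml := @weyl_mixed_antisyml x.
have Mr a b c d := @weyl_mixed_antisymr x a b c d Vx.
rewrite weyl_sqE// -(weyl_quadratic e d Ml Mr); last by move=> *; exact: weyl_mixed_trace.
transitivity (\sum_m \sum_p \sum_a weyl_up3 g G x d a m p * weyl g G x m p a e).
  rewrite exchange_big/=; apply: eq_bigr => m _; exact: exchange_big.
transitivity (\sum_m \sum_p \sum_a
    weyl_mixed g G x d a m p * weyl_mixed g G x m p a e).
  apply: eq_bigr => m _; apply: eq_bigr => p _.
  under eq_bigr do rewrite weyl_up3E//.
  by rewrite (sum_raise _ _ upC).
rewrite [in RHS]exchange_big/= -sumrN; apply: eq_bigr => m _.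
rewrite [in RHS]exchange_big/= -sumrN; apply: eq_bigr => p _.
by rewrite -sumrN; apply: eq_bigr => a _; rewrite (Mr m p e a) mulrN.
Qed.

End Weyl.

(** * Conformal change of the connection and of the curvature *)

(** The gradient of the logarithm of [T]. *)
Definition dlog (R : realType) (n : nat) (T : 'rV[R]_n -> R) (a : 'I_n)
    (y : 'rV[R]_n) : R := partial a T y / T y.

Definition dlog_up (R : realType) (n : nat) (g : components R n 0 2)
    (T : 'rV[R]_n -> R) (a : 'I_n) (y : 'rV[R]_n) : R :=
  \sum_e up g y a e * dlog T e y.

Definition dlog_sq (R : realType) (n : nat) (g : components R n 0 2)
    (T : 'rV[R]_n -> R) (y : 'rV[R]_n) : R :=
  \sum_e dlog_up g T e y * dlog T e y.

Definition dlog_cov (R : realType) (n : nat) (G : coefficients R n)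
    (T : 'rV[R]_n -> R) (a b : 'I_n) (y : 'rV[R]_n) : R :=
  partial a (dlog T b) y - \sum_e G y e a b * dlog T e y.

Definition christoffel_shift (R : realType) (n : nat) (g : components R n 0 2)
    (T : 'rV[R]_n -> R) (y : 'rV[R]_n) (d a b : 'I_n) : R :=
  dlog T a y * (d == b)%:R + dlog T b y * (d == a)%:R
  - lo g y a b * dlog_up g T d y.

Definition schouten_shift (R : realType) (n : nat) (g : components R n 0 2)
    (G : coefficients R n) (T : 'rV[R]_n -> R) (a b : 'I_n) (y : 'rV[R]_n) : R :=
  dlog_cov G T a b y - dlog T a y * dlog T b y
  + 2^-1 * dlog_sq g T y * lo g y a b.

(** [schouten_shift] with its second index raised, see
    [raise_schouten_shift]. *)
Definition schouten_shift_up (R : realType) (n : nat) (g : components R n 0 2)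
    (G : coefficients R n) (T : 'rV[R]_n -> R) (b d : 'I_n) (y : 'rV[R]_n) : R :=
  partial b (dlog_up g T d) y + \sum_e G y d b e * dlog_up g T e y
  - dlog T b y * dlog_up g T d y + 2^-1 * dlog_sq g T y * (d == b)%:R.

(** nabla_m S_{pa} - nabla_p S_{ma}, for a connection without torsion: the
    connection terms on the first index of [S] cancel. *)
Definition cov_curl (R : realType) (n : nat) (D : coefficients R n)
    (S : 'I_n -> 'I_n -> 'rV[R]_n -> R) (m p a : 'I_n) (y : 'rV[R]_n) : R :=
  partial m (S p a) y - partial p (S m a) y
  - \sum_e D y e m a * S p e y + \sum_e D y e p a * S m e y.

Section ConformalChange.
Context {R : realType} {n : nat}.
Context {V : set 'rV[R]_n} {g g' : components R n 0 2}.
Context {G G' : coefficients R n}.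
Context {T : 'rV[R]_n -> R}.
Hypothesis LC : levi_civita_on V g G.
Hypothesis LC' : levi_civita_on V g' G'.
Hypothesis T_smooth : smooth_on V T.
Hypothesis T_neq0 : forall y, V y -> T y != 0.
Hypothesis conf : forall y a b, V y -> lo g' y a b = T y ^+ 2 * lo g y a b.
Implicit Types (x y : 'rV[R]_n) (a b c d e m p : 'I_n).

Local Notation h := (lo g).
Local Notation oV := (lc_open LC).

Local Notation Y := (dlog T).
Local Notation u := (dlog_up g T).
Local Notation N := (dlog_sq g T).
Local Notation DY := (dlog_cov G T).
Local Notation K := (christoffel_shift g T).
Local Notation P := (schouten_shift g G T).
Local Notation Pu := (schouten_shift_up g G T).

Lemma smooth_dlog a : smooth_on V (Y a).
Proof.
by apply: smooth_onM (smooth_on_partial a T_smooth) (smooth_onV _ _ T_smooth);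
  rewrite //; exact: oV.
Qed.

Lemma partial_inv a y : V y ->
  partial a (fun z => (T z)^-1) y = - (T y) ^- 2 * partial a T y.
Proof.
move=> Vy; rewrite /partial deriveV//; first exact: T_neq0.
exact: smooth_on_derivable T_smooth Vy.
Qed.

Lemma partial_dlogC a b y : V y -> partial a (Y b) y = partial b (Y a) y.
Proof.
move=> Vy; have sV := smooth_onV oV T_neq0 T_smooth.
rewrite (partialM _ (smooth_on_partial b T_smooth) sV Vy).
rewrite (partialM _ (smooth_on_partial a T_smooth) sV Vy).
rewrite (partial_inv a Vy) (partial_inv b Vy).
have := partial_comm a b oV T_smooth Vy.
move: (partial a (partial b T) y) (partial b (partial a T) y) => s _ <-.
by move: (partial a T y) (partial b T y) => p q; ring.
Qed.

Lemma smooth_dlog_up a : smooth_on V (u a).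
Proof.
apply: smooth_on_sum; first exact: oV.
move=> e; apply: smooth_onM; [exact: oV | exact: (smooth_up LC) | exact: smooth_dlog].
Qed.

Lemma lower_dlog a y : V y -> \sum_e h y a e * u e y = Y a y.
Proof. by move=> Vy; exact: (lower_raise LC (fun e => Y e y)). Qed.

Lemma up_conformal y a b : V y -> up g' y a b = (T y) ^- 2 * up g y a b.
Proof.
move=> Vy; rewrite /up.
have -> : \matrix_(c, d) lo g' y c d = T y ^+ 2 *: \matrix_(c, d) h y c d.
  by apply/matrixP => i j; rewrite !mxE conf.
by rewrite invmxZ ?mxE// unitmxZ ?unitfE ?expf_neq0 ?T_neq0// (lc_unit LC).
Qed.

(** Koszul's formula: compatibility with the metric and absence of torsion
    determine the connection. *)
Lemma koszul (k : components R n 0 2) (D : coefficients R n) :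
  levi_civita_on V k D -> forall y d a b, V y ->
  2 * \sum_e lo k y d e * D y e a b =
  partial a (fun z => lo k z b d) y + partial b (fun z => lo k z a d) y
  - partial d (fun z => lo k z a b) y.
Proof.
move=> K y d a b Vy; rewrite !(lc_compat K)//.
have S1 i j l : \sum_e D y e i j * lo k y e l = \sum_e lo k y l e * D y e i j.
  by apply: eq_bigr => e _; rewrite mulrC (lc_sym K).
have S2 i j l : \sum_e D y e i j * lo k y l e = \sum_e lo k y l e * D y e i j.
  by apply: eq_bigr => e _; rewrite mulrC.
have S3 i j l : \sum_e lo k y l e * D y e i j = \sum_e lo k y l e * D y e j i.
  by apply: eq_bigr => e _; rewrite (lc_torsion_free K).
rewrite !S1 !S2 (S3 b a d) (S3 d a b) (S3 d b a); ring.
Qed.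

(** Koszul's formula for both metrics, the derivative of [T ^+ 2 * h] being
    [T ^+ 2 * (2 * Y * h + dh)]. *)
Lemma christoffel_conformal y d a b : V y -> G' y d a b = G y d a b + K y d a b.
Proof.
move=> Vy.
have dh' i j k : partial i (fun z => lo g' z j k) y =
    T y ^+ 2 * (2 * Y i y * h y j k + partial i (fun z => h z j k) y).
  rewrite (@eq_partial _ _ V _ (fun z => T z * T z * h z j k))//; last 2 first.
  - exact: oV.
  - by move=> z Vz; rewrite conf// expr2.
  have sT2 := smooth_onM oV T_smooth T_smooth.
  rewrite (partialM _ sT2 (lc_smooth LC j k) Vy) (partialM _ T_smooth T_smooth Vy).
  rewrite /dlog; move: (partial i _ y) (partial i T y) => p q.
  by field; exact: T_neq0.
have low i j k : \sum_e h y k e * G' y e i j =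
    \sum_e h y k e * G y e i j +
    (Y i y * h y j k + Y j y * h y i k - Y k y * h y i j).
  have T2 : T y ^+ 2 != 0 by rewrite expf_neq0 ?T_neq0.
  apply: (mulfI T2); have := koszul LC' k i j Vy; have := koszul LC k i j Vy.
  rewrite !dh'.
  have -> : \sum_e lo g' y k e * G' y e i j =
      T y ^+ 2 * \sum_e h y k e * G' y e i j.
    by rewrite mulr_sumr; apply: eq_bigr => e _; rewrite conf// mulrA.
  move=> E E'; apply: (@mulfI _ 2); rewrite ?pnatr_eq0// E'.
  have dist (t s z : R) : 2 * (t * (s + z)) = t * (2 * s) + t * (2 * z) by ring.
  rewrite dist E.
  move: (partial _ _ _) (partial _ _ _) (partial _ _ _) => p q r.
  ring.
rewrite -[LHS](raise_lower LC (fun d => G' y d a b) d Vy).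
under eq_bigr do rewrite low mulrDr.
rewrite big_split/= (raise_lower LC (fun d => G y d a b) d Vy); congr (_ + _).
rewrite /christoffel_shift /dlog_up mulr_sumr.
rewrite -(sum_up_lo LC d b Vy) -(sum_up_lo LC d a Vy) !mulr_sumr -big_split/= -sumrB.
by apply: eq_bigr => e _; rewrite (lc_sym LC e a)// (lc_sym LC e b)//; ring.
Qed.

Lemma sum_shiftl y a c (X : 'I_n -> R) : \sum_e K y e a c * X e =
  Y a y * X c + Y c y * X a - h y a c * \sum_e u e y * X e.
Proof.
rewrite -[X in Y a y * X](sum_deltal_sym X c) -[X in Y c y * X](sum_deltal_sym X a).
rewrite !mulr_sumr -big_split/= -sumrB; apply: eq_bigr => e _.
by rewrite /christoffel_shift; ring.
Qed.

Lemma sum_shiftr y d b (X : 'I_n -> R) : \sum_e X e * K y d b e =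
  Y b y * X d + (d == b)%:R * \sum_e X e * Y e y - u d y * \sum_e X e * h y b e.
Proof.
rewrite -[X in Y b y * X](sum_deltar X d).
rewrite !mulr_sumr -big_split/= -sumrB; apply: eq_bigr => e _.
by rewrite /christoffel_shift; ring.
Qed.

Lemma dlog_covC a b y : V y -> DY a b y = DY b a y.
Proof.
move=> Vy; rewrite /dlog_cov partial_dlogC//; congr (_ - _).
by apply: eq_bigr => e _; rewrite (lc_torsion_free LC).
Qed.

Lemma schouten_shiftC a b y : V y -> P a b y = P b a y.
Proof.
move=> Vy; rewrite /schouten_shift dlog_covC// (lc_sym LC a b Vy).
by rewrite [Y a y * _]mulrC.
Qed.

Lemma partial_lower_dlog m a y : V y ->
  partial m (Y a) y = \sum_e partial m (fun z => h z a e) y * u e y +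
                      \sum_e h y a e * partial m (u e) y.
Proof.
move=> Vy; rewrite (@eq_partial _ _ V _ (fun z => \sum_e h z a e * u e z))//; last 2 first.
- exact: oV.
- by move=> z Vz; rewrite lower_dlog.
rewrite (partial_sum _ _ Vy); last first.
  by move=> e; apply: smooth_onM; [exact: oV | exact: (lc_smooth LC) | exact: smooth_dlog_up].
rewrite -big_split/=; apply: eq_bigr => e _.
exact: partialM (lc_smooth LC _ _) (smooth_dlog_up _) Vy.
Qed.

(** The metric is covariantly constant: lowering an index commutes with the
    covariant derivative. *)
Lemma lower_schouten_shift a b y : V y -> \sum_d h y a d * Pu b d y = P b a y.
Proof.
move=> Vy; rewrite /schouten_shift_up.
under eq_bigr do rewrite mulrDr mulrBr mulrDr.
rewrite big_split/= sumrB big_split/=.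
have -> : \sum_d h y a d * (2^-1 * N y * (d == b)%:R) = 2^-1 * N y * h y b a.
  rewrite (lc_sym LC b)// -[h y a b](sum_deltar_sym (h y a) b) [RHS]mulr_sumr.
  by apply: eq_bigr => d _; ring.
have -> : \sum_d h y a d * (Y b y * u d y) = Y b y * Y a y.
  by rewrite -[Y a y]lower_dlog// [RHS]mulr_sumr; apply: eq_bigr => d _; ring.
congr (_ - _ + _); rewrite /dlog_cov partial_lower_dlog//.
rewrite addrAC addrC; congr (_ + _).
under [X in _ = X - _]eq_bigr do rewrite (lc_compat LC)// mulrDl.
rewrite big_split/= [X in _ = X + _ - _](_ : _ = \sum_e G y e b a * Y e y); last first.
  under eq_bigr do rewrite mulr_suml.
  rewrite exchange_big/=; apply: eq_bigr => e _; rewrite -lower_dlog// mulr_sumr.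
  by apply: eq_bigr => d _; rewrite mulrA.
rewrite addrC addKr.
under [RHS]eq_bigr do rewrite mulr_suml.
rewrite exchange_big/=; apply: eq_bigr => d _; rewrite mulr_sumr.
by apply: eq_bigr => e _; ring.
Qed.

Lemma raise_schouten_shift b d y : V y -> Pu b d y = \sum_e up g y d e * P b e y.
Proof.
move=> Vy; rewrite -[LHS](raise_lower LC (fun d => Pu b d y) d Vy).
by apply: eq_bigr => e _; rewrite lower_schouten_shift.
Qed.

(** The curvature changes by the covariant curl of [K] and by a term quadratic
    in [K]; together they only involve [dlog] through [P]. *)
Lemma riemann_conformal x a b c d : V x -> riemann G' x a b c d =
  riemann G x a b c d - ((d == b)%:R * P a c x - (d == a)%:R * P b c x
    + h x a c * Pu b d x - h x b c * Pu a d x).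
Proof.
move=> Vx; rewrite (riemannE LC')// (riemannE LC)//.
have dG i j k : partial i (fun y => G' y d j k) x = partial i (fun y => G y d j k) x +
    (partial i (Y j) x * (d == k)%:R + partial i (Y k) x * (d == j)%:R -
     (partial i (fun y => h y j k) x * u d x + h x j k * partial i (u d) x)).
  rewrite (@eq_partial _ _ V _ (fun y => G y d j k + K y d j k))//; last 2 first.
  - exact: oV.
  - by move=> y Vy; exact: christoffel_conformal.
  have sc (r : R) := @smooth_on_cst R n V r.
  have s1 := smooth_onM oV (smooth_dlog j) (sc (d == k)%:R).
  have s2 := smooth_onM oV (smooth_dlog k) (sc (d == j)%:R).
  have s3 := smooth_onM oV (lc_smooth LC j k) (smooth_dlog_up d).
  have s12 := smooth_onD oV s1 s2.
  rewrite (partialD _ (lc_coef_smooth LC d j k) (smooth_onB oV s12 s3) Vx).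
  rewrite (partialB _ s12 s3 Vx) (partialD _ s1 s2 Vx).
  rewrite (partialM _ (smooth_dlog j) (sc _) Vx) (partialM _ (smooth_dlog k) (sc _) Vx).
  rewrite (partialM _ (lc_smooth LC j k) (smooth_dlog_up d) Vx).
  by rewrite !partial_cst !mulr0 !addr0.
have GG i j : \sum_e G' x e i c * G' x d j e =
    \sum_e G x e i c * G x d j e + \sum_e G x e i c * K x d j e +
    (Y i x * G' x d j c + Y c x * G' x d j i -
     h x i c * (\sum_e u e x * G x d j e + \sum_e u e x * K x d j e)).
  have SU : \sum_e u e x * G' x d j e =
      \sum_e u e x * G x d j e + \sum_e u e x * K x d j e.
    by rewrite -big_split; apply: eq_bigr => e _; rewrite christoffel_conformal// mulrDr.
  rewrite -SU -sum_shiftl -!big_split/=; apply: eq_bigr => e _.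
  by rewrite (christoffel_conformal e i c Vx) mulrDl -mulrDr -christoffel_conformal.
have dh i j k : partial i (fun y => h y j k) x =
    \sum_e G x e i j * h x k e + \sum_e G x e i k * h x j e.
  rewrite (lc_compat LC)//; congr (_ + _); apply: eq_bigr => e _.
  by rewrite (lc_sym LC e).
have HC i j k : \sum_e G x e i j * h x k e = \sum_e G x e j i * h x k e.
  by apply: eq_bigr => e _; rewrite (lc_torsion_free LC).
have uh i : \sum_e u e x * h x i e = Y i x.
  by rewrite -lower_dlog//; apply: eq_bigr => e _; rewrite mulrC.
have Gu i : \sum_e G x d i e * u e x = \sum_e u e x * G x d i e.
  by apply: eq_bigr => e _; rewrite mulrC.
rewrite !GG !sum_shiftr !(christoffel_conformal _ _ _ Vx) !dG !dh !uh.
rewrite /schouten_shift_up /schouten_shift /dlog_cov !Gu.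
rewrite (partial_dlogC b a Vx) (HC b a c).
rewrite (lc_torsion_free LC d b a Vx) /christoffel_shift -/(dlog_sq g T x).
rewrite (lc_sym LC b a Vx).
move: (partial _ _ _) (partial _ _ _) (partial _ _ _) (partial _ _ _)
      (partial _ _ _) (partial _ _ _) (partial _ _ _).
by move=> *; field.
Qed.

Lemma sum_shiftl_conformal x a c (X : 'I_n -> R) : V x ->
  \sum_e G' x e a c * X e = \sum_e G x e a c * X e +
    (Y a x * X c + Y c x * X a - h x a c * \sum_e u e x * X e).
Proof.
move=> Vx; rewrite -sum_shiftl -big_split/=; apply: eq_bigr => e _.
by rewrite christoffel_conformal// mulrDl.
Qed.

Lemma smooth_dlog_cov a b : smooth_on V (DY a b).
Proof.
apply: smooth_onB; [exact: oV | exact/smooth_on_partial/smooth_dlog|].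
apply: smooth_on_sum; first exact: oV.
move=> e; apply: smooth_onM; first exact: oV.
  exact: (lc_coef_smooth LC).
exact: smooth_dlog.
Qed.

Lemma smooth_dlog_sq : smooth_on V N.
Proof.
apply: smooth_on_sum; first exact: oV.
by move=> e; apply: smooth_onM; [exact: oV | exact: smooth_dlog_up | exact: smooth_dlog].
Qed.

Lemma smooth_schouten_shift a b : smooth_on V (P a b).
Proof.
have sc (r : R) := @smooth_on_cst R n V r.
apply: smooth_onD; first exact: oV.
  apply: smooth_onB; [exact: oV | exact: smooth_dlog_cov|].
  by apply: smooth_onM; [exact: oV | exact: smooth_dlog | exact: smooth_dlog].
apply: smooth_onM; [exact: oV| | exact: (lc_smooth LC)].
exact: smooth_onM oV (sc _) smooth_dlog_sq.
Qed.

(** The metric is covariantly constant, so that the derivative falls on the two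
    factors [dlog] only. *)
Lemma partial_dlog_sq m y : V y -> partial m N y = 2 * \sum_e u e y * DY m e y.
Proof.
move=> Vy; rewrite (partial_sum _ _ Vy); last first.
  by move=> e; apply: smooth_onM; [exact: oV | exact: smooth_dlog_up | exact: smooth_dlog].
under eq_bigr do rewrite (partialM _ (smooth_dlog_up _) (smooth_dlog _) Vy).
pose D := \sum_a u a y * \sum_f G y f m a * Y f y.
have hu f : \sum_a u a y * h y a f = Y f y.
  by rewrite -lower_dlog//; apply: eq_bigr => a _; rewrite mulrC (lc_sym LC).
have uY : \sum_a u a y * partial m (Y a) y =
    D + D + \sum_a partial m (u a) y * Y a y.
  under eq_bigr do rewrite partial_lower_dlog// mulrDr.
  rewrite big_split/=; congr (_ + _); last first.
    under eq_bigr do rewrite mulr_sumr.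
    rewrite exchange_big/=; apply: eq_bigr => e _.
    by rewrite -hu mulr_sumr; apply: eq_bigr => a _; ring.
  pose Z f := \sum_e G y f m e * u e y.
  have dhu a : \sum_e partial m (fun z => h z a e) y * u e y =
      \sum_f G y f m a * Y f y + \sum_f h y a f * Z f.
    under eq_bigr do rewrite (lc_compat LC)// mulrDl.
    rewrite big_split/=; congr (_ + _).
      under eq_bigr do rewrite mulr_suml.
      rewrite exchange_big/=; apply: eq_bigr => f _.
      by rewrite -lower_dlog// mulr_sumr; apply: eq_bigr => e _; ring.
    under eq_bigr do rewrite mulr_suml.
    rewrite exchange_big/=; apply: eq_bigr => f _.
    by rewrite mulr_sumr; apply: eq_bigr => e _; ring.
  under eq_bigr do rewrite dhu mulrDr.
  rewrite big_split/=; congr (_ + _).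
  transitivity (\sum_f Y f y * Z f).
    under eq_bigr do rewrite mulr_sumr.
    rewrite exchange_big/=; apply: eq_bigr => f _.
    by rewrite -hu mulr_suml; apply: eq_bigr => a _; ring.
  under eq_bigr do rewrite mulr_sumr.
  rewrite exchange_big/=; apply: eq_bigr => a _.
  by rewrite mulr_sumr; apply: eq_bigr => f _; ring.
rewrite big_split/= /dlog_cov.
under [X in _ = 2 * X]eq_bigr do rewrite mulrBr.
rewrite sumrB -/D uY.
have fin (A B : R) : A + (B + B + A) = 2 * (B + B + A - B) by ring.
exact: fin.
Qed.

Lemma sum_dlog_cov m y : 
  \sum_e u e y * DY m e y = \sum_e u e y * P m e y + Y m y * N y -
    2^-1 * N y * \sum_e u e y * h y m e.
Proof.
have -> : Y m y * N y = \sum_e u e y * (Y m y * Y e y).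
  by rewrite [LHS]mulr_sumr; apply: eq_bigr => e _; rewrite mulrCA.
have -> : 2^-1 * N y * \sum_e u e y * h y m e = \sum_e u e y * (2^-1 * N y * h y m e).
  by rewrite [LHS]mulr_sumr; apply: eq_bigr => e _; rewrite mulrCA.
rewrite -big_split/= -sumrB; apply: eq_bigr => e _.
rewrite -mulrDr -mulrBr; congr (_ * _); rewrite /schouten_shift.
by ring.
Qed.

(** The second derivatives of [dlog] contribute the curvature, by the Ricci
    identity; the first derivatives are eliminated in favour of [P]. *)
Lemma cov_curl_schouten_shift m p a y : V y ->
  cov_curl G P m p a y =
  \sum_e riemann G y m p a e * Y e y
  + Y m y * P p a y - Y p y * P m a y
  + h y p a * \sum_e u e y * P m e y - h y m a * \sum_e u e y * P p e y.
Proof.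
move=> Vy; have uh i : \sum_e u e y * h y i e = Y i y.
  by rewrite -lower_dlog//; apply: eq_bigr => e _; rewrite mulrC.
have sc (r : R) := @smooth_on_cst R n V r.
have dP i j k : partial i (P j k) y = partial i (DY j k) y -
    (partial i (Y j) y * Y k y + Y j y * partial i (Y k) y) +
    ((\sum_e u e y * P i e y + 2^-1 * N y * Y i y) * h y j k +
     2^-1 * N y * partial i (fun z => h z j k) y).
  have s1 := smooth_onM oV (smooth_dlog j) (smooth_dlog k).
  have s2 := smooth_onM oV (sc 2^-1) smooth_dlog_sq.
  have s3 := smooth_onM oV s2 (lc_smooth LC j k).
  rewrite (partialD _ (smooth_onB oV (smooth_dlog_cov j k) s1) s3 Vy).
  rewrite (partialB _ (smooth_dlog_cov j k) s1 Vy).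
  rewrite (partialM _ (smooth_dlog j) (smooth_dlog k) Vy).
  rewrite (partialM _ s2 (lc_smooth LC j k) Vy) (partialM _ (sc _) smooth_dlog_sq Vy).
  rewrite partial_cst mul0r add0r partial_dlog_sq// sum_dlog_cov uh.
  by congr (_ + (_ * _ + _)); field.
have GP i j k : \sum_e G y e i k * P j e y = \sum_e G y e i k * DY j e y -
    Y j y * \sum_e G y e i k * Y e y + 2^-1 * N y * \sum_e G y e i k * h y j e.
  have -> : 2^-1 * N y * \sum_e G y e i k * h y j e =
      \sum_e 2^-1 * N y * (G y e i k * h y j e) by rewrite [LHS]mulr_sumr.
  rewrite [X in _ - X]mulr_sumr -sumrB -big_split/=; apply: eq_bigr => e _.
  by rewrite /schouten_shift; ring.
have dh i j k : partial i (fun y => h y j k) y =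
    \sum_e G y e i j * h y k e + \sum_e G y e i k * h y j e.
  rewrite (lc_compat LC)//; congr (_ + _); apply: eq_bigr => e _.
  by rewrite (lc_sym LC e).
have HC i j k : \sum_e G y e i j * h y k e = \sum_e G y e j i * h y k e.
  by apply: eq_bigr => e _; rewrite (lc_torsion_free LC).
have RI := ricci_identity LC m p a smooth_dlog Vy.
rewrite /cov_curl !dP !GP !dh -RI (HC m p a) (partial_dlogC p m Vy).
have PE i j : P i j y = partial i (Y j) y - \sum_e G y e i j * Y e y -
   Y i y * Y j y + 2^-1 * N y * h y i j by [].
rewrite (PE p a) (PE m a).
move: (\sum_e u e y * P m e y) (\sum_e u e y * P p e y).
rewrite /dlog_cov.
move: (partial _ _ _) (partial _ _ _) (partial _ _ _) (partial _ _ _) (partial _ _ _).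
by move=> *; field.
Qed.

Lemma cov_curl_conformal (S : 'I_n -> 'I_n -> 'rV[R]_n -> R) m p a y : V y ->
  S m p y = S p m y -> cov_curl G' S m p a y = cov_curl G S m p a y
  - Y m y * S p a y + Y p y * S m a y
  + h y m a * \sum_e u e y * S p e y - h y p a * \sum_e u e y * S m e y.
Proof.
move=> Vy Smp; rewrite /cov_curl !sum_shiftl_conformal// Smp; ring.
Qed.

End ConformalChange.

(** * Conformal change of the Weyl and Cotton tensors *)

Section ConformalChange4.
Context {R : realType}.
Context {V : set 'rV[R]_4} {g g' : components R 4 0 2}.
Context {G G' : coefficients R 4}.
Context {T : 'rV[R]_4 -> R}.
Hypothesis LC : levi_civita_on V g G.
Hypothesis LC' : levi_civita_on V g' G'.
Hypothesis T_smooth : smooth_on V T.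
Hypothesis T_neq0 : forall y, V y -> T y != 0.
Hypothesis conf : forall y a b, V y -> lo g' y a b = T y ^+ 2 * lo g y a b.
Implicit Types (x y : 'rV[R]_4) (a b c d e m p : 'I_4).

Local Notation h := (lo g).
Local Notation oV := (lc_open LC).
Local Notation L := (lo (schouten g G)).
Local Notation L' := (lo (schouten g' G')).
Local Notation Y := (dlog T).
Local Notation u := (dlog_up g T).
Local Notation P := (schouten_shift g G T).
Local Notation Pu := (schouten_shift_up g G T).

Let raise_shift := raise_schouten_shift LC T_smooth T_neq0.
Let lower_shift := lower_schouten_shift LC T_smooth T_neq0.
Let shiftC := schouten_shiftC LC T_smooth T_neq0.
Let upE := up_conformal LC T_neq0 conf.

Lemma ricci_conformal x a c : V x -> ricci G' x a c =
  ricci G x a c - 2 * P a c x - h x a c * \sum_b Pu b b x.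
Proof.
move=> Vx; rewrite /ricci.
under eq_bigr do rewrite (riemann_conformal LC LC' T_smooth T_neq0 conf)//.
have sumE (F1 F2 F3 F4 F5 : 'I_4 -> R) :
    \sum_b (F1 b - (F2 b - F3 b + F4 b - F5 b)) =
    \sum_b F1 b - (\sum_b F2 b - \sum_b F3 b + \sum_b F4 b - \sum_b F5 b).
  by rewrite sumrB sumrB big_split/= sumrB.
rewrite (sumE (fun b => riemann G x a b c b)) sum_deltal_sym -mulr_sumr -mulr_suml.
have -> : \sum_(b < 4) (b == b)%:R = 4 :> R.
  by rewrite (eq_bigr (fun=> 1)) ?sumr_const ?card_ord// => b _; rewrite eqxx.
have -> : \sum_b h x b c * Pu a b x = P a c x.
  by rewrite -lower_shift//; apply: eq_bigr => b _; rewrite (lc_sym LC).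
move: (\sum_b _) (\sum_b _) => r s; ring.
Qed.

Lemma scalar_curvature_conformal x : V x ->
  scalar_curvature g' G' x =
  (T x) ^- 2 * (scalar_curvature g G x - 6 * \sum_b Pu b b x).
Proof.
move=> Vx; pose t := \sum_b Pu b b x.
transitivity ((T x) ^- 2 * (scalar_curvature g G x -
    2 * \sum_a \sum_b up g x a b * P a b x -
    (\sum_a \sum_b up g x a b * h x a b) * t)).
  rewrite /scalar_curvature mulr_sumr mulr_suml -!sumrB mulr_sumr.
  apply: eq_bigr => a _; rewrite mulr_sumr mulr_suml -!sumrB mulr_sumr.
  apply: eq_bigr => b _; rewrite ricci_conformal// upE// -/t.
  by move: t (ricci _ _ _ _) => t r; ring.
rewrite (sum_up_loT LC)// -/t.
have -> : \sum_a \sum_b up g x a b * P a b x = t.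
  by apply: eq_bigr => a _; rewrite raise_shift.
by move: t (scalar_curvature _ _ _) => t r; ring.
Qed.

(** The normalisation of the Schouten tensor inverts the trace of
    [riemann_conformal]. *)
Lemma schouten_conformal x a b : V x -> L' x a b = L x a b - P a b x.
Proof.
move=> Vx; rewrite !schoutenE ricci_conformal// scalar_curvature_conformal// conf//.
move: (ricci _ _ _ _) (scalar_curvature _ _ _) (\sum_b _) => r s t.
by field; exact: T_neq0.
Qed.

Lemma schouten_mixed_conformal x a b : V x ->
  schouten_mixed g' G' x a b = (T x) ^- 2 * (schouten_mixed g G x a b - Pu b a x).
Proof.
move=> Vx; rewrite raise_shift// -sumrB mulr_sumr; apply: eq_bigr => e _.
by rewrite schouten_conformal// upE// (shiftC b)//; ring.
Qed.

(** The change of the curvature and that of the Schouten terms have the same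
    shape and cancel. *)
Lemma weyl_conformal x a b c d : V x -> weyl g' G' x a b c d = weyl g G x a b c d.
Proof.
move=> Vx; rewrite !weylE (riemann_conformal LC LC' T_smooth T_neq0 conf)//.
rewrite !schouten_conformal// !schouten_mixed_conformal// !conf//.
move: (riemann _ _ _ _ _ _) => r.
move: (schouten_mixed _ _ _ _ _) (schouten_mixed _ _ _ _ _) => s t.
by field; exact: T_neq0.
Qed.

Lemma weyl_lo_conformal x a b c d : V x ->
  weyl_lo g' G' x a b c d = T x ^+ 2 * weyl_lo g G x a b c d.
Proof.
move=> Vx; rewrite [RHS]mulr_sumr; apply: eq_bigr => e _.
by rewrite weyl_conformal// conf//; ring.
Qed.

Lemma weyl_up3_conformal x a b c d : V x ->
  weyl_up3 g' G' x a b c d = (T x) ^- 4 * weyl_up3 g G x a b c d.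
Proof.
move=> Vx; do 3!(rewrite [RHS]mulr_sumr; apply: eq_bigr => ? _).
rewrite weyl_lo_conformal// !upE//; move: (weyl_lo _ _ _ _ _ _ _) => r.
by field; exact: T_neq0.
Qed.

Lemma weyl_sq_conformal x : V x ->
  weyl_sq g' G' x = (T x) ^- 4 * weyl_sq g G x.
Proof.
move=> Vx; rewrite [RHS]mulr_sumr; apply: eq_bigr => a _.
rewrite [RHS]mulr_sumr; apply: eq_bigr => b _.
rewrite [RHS]mulr_sumr; apply: eq_bigr => c _.
rewrite [RHS]mulr_sumr; apply: eq_bigr => d _.
rewrite weyl_lo_conformal//.
rewrite (eq_bigr (fun e =>
  (T x) ^- 6 * (up g x a e * weyl_up3 g G x e b c d))); last first.
  move=> e _; rewrite weyl_up3_conformal// upE//.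
  by move: (weyl_up3 _ _ _ _ _ _ _) => r; field; exact: T_neq0.
rewrite -mulr_sumr; move: (weyl_lo _ _ _ _ _ _ _) (\sum_e _) => r s.
by field; exact: T_neq0.
Qed.

Lemma smooth_riemann a b c d : smooth_on V (fun y => riemann G y a b c d).
Proof.
have sGG i j : smooth_on V (fun y => \sum_e G y e i c * G y d j e).
  apply: smooth_on_sum; first exact: oV.
  by move=> e; apply: smooth_onM; [exact: oV | |]; exact: (lc_coef_smooth LC).
have sdG i j : smooth_on V (partial i (fun y => G y d j c)).
  by apply: smooth_on_partial; exact: (lc_coef_smooth LC).
apply: (smooth_on_ext oV _ (smooth_onB oV (smooth_onD oV
  (smooth_onB oV (sdG b a) (sdG a b)) (sGG a b)) (sGG b a))) => y Vy.
by rewrite (riemannE LC).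
Qed.

Lemma smooth_schouten a b : smooth_on V (fun y => L y a b).
Proof.
have sc (r : R) := @smooth_on_cst R 4 V r.
have sr i j : smooth_on V (fun y => ricci G y i j).
  by apply: smooth_on_sum; [exact: oV | move=> e; exact: smooth_riemann].
have ss : smooth_on V (scalar_curvature g G).
  do 2!(apply: smooth_on_sum; [exact: oV | move=> ?]).
  by apply: smooth_onM; [exact: oV | exact: (smooth_up LC) | exact: sr].
exact: smooth_onM oV (sc _) (smooth_onB oV (sr _ _)
  (smooth_onM oV (smooth_onM oV (sc _) ss) (lc_smooth LC _ _))).
Qed.

Lemma asym_cov_schouten (k : components R 4 0 2) (D : coefficients R 4) x m p a :
  levi_civita_on V k D -> V x ->
  asym (fun m' p' => cov D (schouten k D) x [tuple] [tuple m'; p'; a]) m p =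
  2^-1 * cov_curl D (fun a b y => lo (schouten k D) y a b) m p a x.
Proof.
move=> KD Vx; rewrite /asym; congr (_ * _); rewrite !cov02E /cov_curl.
have -> : \sum_e D x e p m * schouten k D x [tuple] [tuple e; a] =
          \sum_e D x e m p * schouten k D x [tuple] [tuple e; a].
  by apply: eq_bigr => e _; rewrite (lc_torsion_free KD).
rewrite /lo.
move: (partial _ _ _) (partial _ _ _) => q r.
move: (\sum_e _) (\sum_e _) (\sum_e _) => s t v; ring.
Qed.

(** The curvature contracted with [Y], coming from
    [cov_curl_schouten_shift], loses its Schouten part against the change of the
    connection; the Weyl tensor is what remains. *)
Lemma cov_curl_schouten_conformal x m p a : V x ->
  cov_curl G' (fun a b y => L' y a b) m p a x =
  cov_curl G (fun a b y => L y a b) m p a x - \sum_e weyl g G x m p a e * Y e x.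
Proof.
move=> Vx; pose S a b y := L y a b - P a b y.
have sP := smooth_schouten_shift LC T_smooth T_neq0.
transitivity (cov_curl G' S m p a x).
  have pS i j k : partial i (fun y => L' y j k) x = partial i (S j k) x.
    by apply: eq_partial oV _ Vx => y Vy; rewrite schouten_conformal.
  rewrite /cov_curl !pS; congr (_ - _ + _); apply: eq_bigr => e _;
    by rewrite schouten_conformal.
rewrite (cov_curl_conformal LC LC' T_smooth T_neq0 conf)//; last first.
  by rewrite /S (schouten_sym LC)// shiftC.
have -> : cov_curl G S m p a x =
    cov_curl G (fun a b y => L y a b) m p a x - cov_curl G P m p a x.
  have pS i j k : partial i (S j k) x =
      partial i (fun y => L y j k) x - partial i (P j k) x.
    exact: partialB (smooth_schouten j k) (sP j k) Vx.
  have sS i j k : \sum_e G x e i k * S j e x =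
      \sum_e G x e i k * L x j e - \sum_e G x e i k * P j e x.
    by rewrite -sumrB; apply: eq_bigr => e _; rewrite mulrBr.
  rewrite /cov_curl !pS !sS.
  move: (partial _ _ _) (partial _ _ _) (partial _ _ _) (partial _ _ _).
  move: (\sum_e _) (\sum_e _) (\sum_e _) (\sum_e _) => *; ring.
rewrite (cov_curl_schouten_shift LC T_smooth T_neq0)//.
have uS i : \sum_e u e x * S i e x = \sum_e u e x * L x i e - \sum_e u e x * P i e x.
  by rewrite -sumrB; apply: eq_bigr => e _; rewrite mulrBr.
have mixY i : \sum_e schouten_mixed g G x e i * Y e x = \sum_e u e x * L x i e.
  rewrite (sum_raise (fun e => L x e i) (fun e => Y e x) (fun a b => up_sym LC a b Vx)).
  by apply: eq_bigr => e _; rewrite mulrC (schouten_sym LC).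
have -> : \sum_e weyl g G x m p a e * Y e x = \sum_e riemann G x m p a e * Y e x
    - (h x m a * \sum_e u e x * L x p e - h x p a * \sum_e u e x * L x m e)
    - (Y p x * L x m a - Y m x * L x p a).
  rewrite -!mixY -[X in X * L x m a](sum_deltal_sym (fun e => Y e x)).
  rewrite -[X in X * L x p a](sum_deltal_sym (fun e => Y e x)).
  rewrite !mulr_sumr !mulr_suml -!sumrB; apply: eq_bigr => e _.
  by rewrite weylE; move: (riemann _ _ _ _ _ _) => r; ring.
rewrite !uS /S.
move: (cov_curl _ _ _ _ _ _) => q.
move: (\sum_e _) (\sum_e _) (\sum_e _) (\sum_e _) (\sum_e _) => *; ring.
Qed.

(** The numerator and the denominator both scale by [T ^- 4]; the new term of
    the numerator is a multiple of the denominator by [weyl_up3_weyl]. *)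
Lemma Lambda_conformal x d : V x -> weyl_sq g' G' x != 0 ->
  Lambda g' G' x d = Lambda g G x d + Y d x.
Proof.
move=> Vx; rewrite weyl_sq_conformal// mulf_eq0 negb_or => /andP[_ sq0].
rewrite /Lambda weyl_sq_conformal//.
under eq_bigr do under eq_bigr do under eq_bigr do
  rewrite (asym_cov_schouten _ _ _ LC')// weyl_up3_conformal//
    cov_curl_schouten_conformal//.
under [in RHS]eq_bigr do under eq_bigr do under eq_bigr do
  rewrite (asym_cov_schouten _ _ _ LC)//.
have num : \sum_a \sum_m \sum_p weyl_up3 g G x d a m p *
    \sum_e weyl g G x m p a e * Y e x = - (4^-1 * weyl_sq g G x * Y d x).
  transitivity (\sum_e (\sum_a \sum_m \sum_p
      weyl_up3 g G x d a m p * weyl g G x m p a e) * Y e x).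
    do 3!(under [RHS]eq_bigr do rewrite mulr_suml;
          rewrite [RHS]exchange_big/=; apply: eq_bigr => ? _).
    by rewrite mulr_sumr; apply: eq_bigr => e _; rewrite mulrA.
  under eq_bigr do rewrite (weyl_up3_weyl LC)//.
  rewrite -[Y d x](sum_deltal (fun e => Y e x)) mulr_sumr -sumrN.
  by apply: eq_bigr => e _; move: (weyl_sq _ _ _) => r; field.
have -> : \sum_a \sum_m \sum_p T x ^- 4 * weyl_up3 g G x d a m p *
    (2^-1 * (cov_curl G (fun a b y => L y a b) m p a x -
             \sum_e weyl g G x m p a e * Y e x)) =
    T x ^- 4 * (\sum_a \sum_m \sum_p weyl_up3 g G x d a m p *
      (2^-1 * cov_curl G (fun a b y => L y a b) m p a x) -
    2^-1 * \sum_a \sum_m \sum_p weyl_up3 g G x d a m p *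
      \sum_e weyl g G x m p a e * Y e x).
  do 3!(rewrite [X in _ - X]mulr_sumr -sumrB [RHS]mulr_sumr; apply: eq_bigr => ? _).
  by move: (weyl_up3 _ _ _ _ _ _ _) (cov_curl _ _ _ _ _ _) (\sum_e _) => r s t; ring.
rewrite num.
move: (\sum_a _) (weyl_sq _ _ _) sq0 => s r r0.
by field; rewrite r0 T_neq0.
Qed.

End ConformalChange4.

(** * Invariance of the connection *)

Section OnManifold.
Context {R : realType} {n : nat} (M : manifold R n).

Lemma levi_civita_in_chart (g : metric M) (D : connection M) (i : chart M) :
  levi_civita g D -> levi_civita_on (cod i) (g i) (D i).
Proof.
move=> [Dtf Dg]; split.
- exact: cod_open.
- by move=> a b s x ix; apply: (tensor_smooth g).
- by move=> c a b; exact: connection_smooth.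
- by move=> y iy; exact: metric_nondegenerate.
- by move=> y a b iy; exact: Defs.metric_sym.
- by move=> y c a b iy; exact: Dtf.
- move=> x m a b ix; have := Dg i x [tuple] [tuple m; a; b] ix.
  by rewrite cov02E -addrA -opprD => /eqP; rewrite subr_eq0 => /eqP.
Qed.

End OnManifold.

(** A connection is determined by its action on the coordinate forms, whose
    components are constant in their own chart. *)
Lemma C_connection_coef (R : realType) (M : manifold R 4) (g : metric M)
    (D C : connection M) (i : chart M) x d a b :
  C_connection g D C -> cod i x ->
  C i x d a b = D i x d a b - Lambda (g i) (D i) x a * (d == b)%:R
    - Lambda (g i) (D i) x b * (d == a)%:R
    + lo (g i) x a b * \sum_e up (g i) x d e * Lambda (g i) (D i) x e.
Proof.
move=> [_ CE] ix.
have := CE _ (coordinate_form i d) (@dom_open _ _ M i) i x a b ix (psi_dom ix).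
rewrite /= !cov01E !theadE.
have dxE (F : 'I_4 -> R) :
    \sum_e F e * coordinate_form i d i x [tuple] [tuple e] = F d.
  rewrite -[RHS](sum_deltar F); apply: eq_bigr => e _.
  by rewrite /= theadE jac_id.
rewrite !dxE !jac_id//.
have -> : \sum_(c < 4) \sum_(e < 4) up (g i) x c e * Lambda (g i) (D i) x e *
      jac i i x d (thead [tuple c]) =
    \sum_e up (g i) x d e * Lambda (g i) (D i) x e.
  rewrite -[RHS](sum_deltar (fun c => \sum_e up (g i) x c e * Lambda (g i) (D i) x e)).
  by apply: eq_bigr => c _; rewrite mulr_suml theadE jac_id.
move: (partial _ _ _) (\sum_e _) (Lambda _ _ _ a) (Lambda _ _ _ b) => p s la lb E.
have -> : C i x d a b = p - (p - C i x d a b) by ring.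
by rewrite E; ring.
Qed.

Theorem theorem3 (R : realType) (M : manifold R 4) (g gt : metric M)
    (Theta : M -> R) (nabla nablat : connection M)
    (Theta_smooth : smooth_function Theta)
    (Theta_gt0 : forall p : M, 0 < Theta p)
    (conformal : forall (i : chart M) (x : 'rV[R]_4) (a b : 'I_4), cod i x ->
       lo (g i) x a b = Theta (psi i x) ^+ 2 * lo (gt i) x a b)
    (nabla_LC : levi_civita g nabla) (nablat_LC : levi_civita gt nablat)
    (CC_neq0 : forall (i : chart M) (x : 'rV[R]_4), cod i x ->
       weyl_sq (g i) (nabla i) x != 0)
    (C Ct : connection M)
    (C_def : C_connection g nabla C) (Ct_def : C_connection gt nablat Ct) :
  forall (W : set M) (r s : nat) (T : tensor_field W r s), open W ->
  forall (i : chart M) (x : 'rV[R]_4), cod i x -> W (psi i x) ->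
  forall (U : r.-tuple 'I_4) (L : s.+1.-tuple 'I_4),
    cov (Ct i) (T i) x U L = cov (C i) (T i) x U L.
Proof.
move=> W r s T oW i x ix Wx U L; apply: eq_cov => d a b.
rewrite (C_connection_coef d a b C_def ix) (C_connection_coef d a b Ct_def ix).
have LC := levi_civita_in_chart i nabla_LC.
have LCt := levi_civita_in_chart i nablat_LC.
pose S (y : 'rV[R]_4) := Theta (psi i y).
have S_neq0 y : cod i y -> S y != 0 by move=> _; exact: lt0r_neq0 (Theta_gt0 _).
have conf y c e : cod i y -> lo (g i) y c e = S y ^+ 2 * lo (gt i) y c e.
  exact: conformal.
have LE c := Lambda_conformal LCt LC (Theta_smooth i) S_neq0 conf c ix
  (CC_neq0 i x ix).
rewrite (christoffel_conformal LCt LC (Theta_smooth i) S_neq0 conf d a b ix).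
rewrite (LE a) (LE b) conf//.
have -> : \sum_e up (g i) x d e * Lambda (g i) (nabla i) x e =
    S x ^- 2 * (\sum_e up (gt i) x d e * Lambda (gt i) (nablat i) x e +
                dlog_up (gt i) S d x).
  rewrite -big_split/= mulr_sumr; apply: eq_bigr => e _.
  by rewrite (up_conformal LCt S_neq0 conf)// LE; ring.
rewrite /christoffel_shift.
move: (\sum_e _) (dlog_up _ _ _ _) (Lambda _ _ _ _) (Lambda _ _ _ _) => q u la lb.
by field; exact: S_neq0.
Qed.
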